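(* For every $n\ge 2$, there is a fixed rational subset of the wreath product $\mathbb Z/n\mathbb Z\wr(\mathbb Z\times\mathbb Z)$ whose membership problem is undecidable.
   Context: $\mathbb Z/n\mathbb Z\wr(\mathbb Z\times\mathbb Z)$ is the semidirect product $(\mathbb Z/n\mathbb Z)[\mathbb Z\times\mathbb Z]\rtimes(\mathbb Z\times\mathbb Z)$ with $\mathbb Z\times\mathbb Z$ acting on the group ring by left multiplication. For a group $H$ with finite generating set $\Delta$ and canonical map $\pi:(\Delta\cup\Delta^{-1})^*\to H$, a rational subset is a set $\pi(L)$ with $L$ a regular language over $\Delta\cup\Delta^{-1}$; its membership problem asks, given a word $w$, whether $\pi(w)\in\pi(L)$. *)

(* Defs.v *)
From mathcomp Require Import all_boot all_algebra.
Set Implicit Arguments. Unset Strict Implicit. Unset Printing Implicit Defensive.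
Import GRing.Theory.
Local Open Scope ring_scope.

(* The wreath product  Z/nZ wr (Z x Z)  =  (Z/nZ)[Z x Z] ⋊ (Z x Z).    *)
(* An element is a pair (f, v) with f : Z x Z -> Z/nZ the coefficient  *)
(* function of an element of the group ring and v in Z x Z.            *)
(* Z x Z acts by left multiplication: (v . g)(p) = g(p - v).           *)
(* Product: (f, v)(g, w) = (f + v . g, v + w).                          *)
(* ('Z_n is Z/nZ as soon as n >= 2, which the theorem assumes.)         *)
Definition pt := (int * int)%type.
Definition ptadd (p q : pt) : pt := (p.1 + q.1, p.2 + q.2).
Definition ptsub (p q : pt) : pt := (p.1 - q.1, p.2 - q.2).

Definition welem (n : nat) := ((pt -> 'Z_n) * pt)%type.

Definition wone (n : nat) : welem n := (fun _ => 0, (0, 0)).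
Definition wmul (n : nat) (x y : welem n) : welem n :=
  (fun p => x.1 p + y.1 (ptsub p x.2), ptadd x.2 y.2).
Definition weq (n : nat) (x y : welem n) : Prop :=
  (forall p, x.1 p = y.1 p) /\ x.2 = y.2.

Inductive letter := La | LaI | Lt | LtI | Ls | LsI.

Definition delta0 (n : nat) (c : 'Z_n) : pt -> 'Z_n :=
  fun p => if (p.1 == 0) && (p.2 == 0) then c else 0.

Definition gen (n : nat) (x : letter) : welem n :=
  match x with
  | La  => (delta0 1, (0, 0))
  | LaI => (delta0 (-1), (0, 0))
  | Lt  => (fun _ => 0, (1, 0))
  | LtI => (fun _ => 0, (-1, 0))
  | Ls  => (fun _ => 0, (0, 1))
  | LsI => (fun _ => 0, (0, -1))
  end.

Definition word := seq letter.

Definition piw (n : nat) (w : word) : welem n :=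
  foldr (fun x acc => wmul (gen n x) acc) (wone n) w.

Record dfa := DFA {
  dfa_size : nat;
  dfa_start : 'I_dfa_size;
  dfa_final : 'I_dfa_size -> bool;
  dfa_trans : 'I_dfa_size -> letter -> 'I_dfa_size }.

Definition dfa_accepts (A : dfa) (w : word) : bool :=
  @dfa_final A (foldl (@dfa_trans A) (@dfa_start A) w).

Definition rat_mem (n : nat) (A : dfa) (w : word) : Prop :=
  exists u : word, dfa_accepts A u /\ weq (piw n u) (piw n w).

Inductive recf :=
  | RZero
  | RSucc
  | RProj (i : nat)
  | RComp (f : recf) (gs : seq recf)
  | RPrim (f g : recf)
  | RMu (f : recf).

Inductive reval : recf -> seq nat -> nat -> Prop :=
  | ev_zero v : reval RZero v 0%N
  | ev_succ v : reval RSucc v (nth 0 v 0).+1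
  | ev_proj i v : reval (RProj i) v (nth 0 v i)
  | ev_comp f gs v ys y :
      revals gs v ys -> reval f ys y -> reval (RComp f gs) v y
  | ev_prim0 f g v y : reval f v y -> reval (RPrim f g) (0%N :: v) y
  | ev_primS f g x v z y :
      reval (RPrim f g) (x :: v) z -> reval g (x :: z :: v) y ->
      reval (RPrim f g) (x.+1 :: v) y
  | ev_mu f v x :
      reval f (x :: v) 0%N ->
      (forall y, (y < x)%N -> exists z, reval f (y :: v) z.+1) ->
      reval (RMu f) v x
with revals : seq recf -> seq nat -> seq nat -> Prop :=
  | evs_nil v : revals [::] v [::]
  | evs_cons g gs v y ys :
      reval g v y -> revals gs v ys -> revals (g :: gs) v (y :: ys).

Definition letter_code (x : letter) : nat :=
  match x with La => 1%N | LaI => 2%N | Lt => 3%N | LtI => 4%N | Ls => 5%N | LsI => 6%N end.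
Fixpoint encode (w : word) : nat :=
  match w with [::] => 0%N | x :: w' => (letter_code x + 7 * encode w')%N end.

Definition decidable_words (P : word -> Prop) : Prop :=
  exists f : recf, forall w : word,
    (P w -> reval f [:: encode w] 1%N) /\ (~ P w -> reval f [:: encode w] 0%N).

(* Main.v *)
Require Import Defs.
From mathcomp Require Import all_boot all_order all_algebra.
From mathcomp Require Import zify ring.
Set Implicit Arguments. Unset Strict Implicit. Unset Printing Implicit Defensive.
Import Order.TTheory GRing.Theory Num.Theory.

(* A path in the group toggles lamps along the rows of the grid Z x Z. Row j erases (-1) a word
   of colours, coded one-hot in a horizontal band of height H, and writes (+1) a word in the next
   band; all lamps cancel iff every row erases exactly what the previous one wrote, so rational
   subsets simulate iterated letter-to-letter transducers on words of arbitrary length. The input k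
   enters as the target t^k a^-1, whose single lamp must be cancelled by a mark in the first row.

   Words encode registers bounded by the length N as marked positions, together with a guessed set
   X of numbers, and a program tests that every element of X is a fact (e on v yields y) about
   mu-recursive functions which is justified by other facts of X. If e really evaluates to y on v,
   then, by induction on the evaluation, some finite justified X contains this fact, and no
   justified X contains (e on v yields z) with z <> y. Taking e = k and v = [k], for a code k of
   the function that applies a putative decision procedure to t^k a^-1, the membership of that word
   holds iff the procedure answers 0. *)

(** * Regular expressions *)

(** Decidability refers to the functions [recf], so a reduction from a halting problem would call
    for a universal function written in [recf]. Here the rational subset itself is the universal
    machine: it checks evaluations of every code, and the only function to be programmed is k |->
    [encode (target k)].

    Nested recursion would need a stack. A guessed set X replaces it: one bit per position, copied
    from row to row, turns the check of a computation into independent tests, one for each number up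
    to the bound. Membership being existential, every guess (X, the bound, loop lengths, walks) is
    free as long as wrong guesses block.

    The obstacle in the group is that the automaton knows neither its column nor the length of the
    word, and that lamps are counted modulo n. Rows climb strictly, so the lowest unsettled band is
    reached by one writer and one eraser only, each touching a lamp at most once. Cancellation there
    is equality of two sets, for n = 2 as well, and the bands are settled one after the other. *)

Inductive re (A : Type) : Type :=
  | Emp | Eps | Sym (a : A) | Alt (e1 e2 : re A) | Cat (e1 e2 : re A) | Star (e : re A).
Arguments Emp {A}. Arguments Eps {A}.

Inductive star (A : Type) (L : seq A -> Prop) : seq A -> Prop :=
  | star_nil : star L [::]
  | star_cons u v : L u -> star L v -> star L (u ++ v).

Definition catl (A : Type) (L1 L2 : seq A -> Prop) (w : seq A) : Prop :=
  exists u v, [/\ w = u ++ v, L1 u & L2 v].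

Fixpoint lang (A : Type) (e : re A) : seq A -> Prop :=
  match e with
  | Emp => fun _ => False
  | Eps => fun w => w = [::]
  | Sym a => fun w => w = [:: a]
  | Alt e1 e2 => fun w => lang e1 w \/ lang e2 w
  | Cat e1 e2 => catl (lang e1) (lang e2)
  | Star e => star (lang e)
  end.

Lemma star_cat A (L : seq A -> Prop) u v : star L u -> star L v -> star L (u ++ v).
Proof. by elim=> // a b La _ IH /IH sv; rewrite -catA; apply: star_cons. Qed.

Lemma star_consE A (L : seq A -> Prop) x w :
  star L (x :: w) <-> exists u v, [/\ w = u ++ v, L (x :: u) & star L v].
Proof.
split=> [|[u [v [-> Lu sv]]]]; last by rewrite -cat_cons; apply: star_cons.
move eqz : (x :: w) => z sz; elim: sz x w eqz => // [[|y u] v] Lu sv IH x w //=.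
  exact: IH.
by case=> -> ->; exists u, v.
Qed.

Fixpoint bind (A B : Type) (f : A -> re B) (e : re A) : re B :=
  match e with
  | Emp => Emp
  | Eps => Eps
  | Sym a => f a
  | Alt e1 e2 => Alt (bind f e1) (bind f e2)
  | Cat e1 e2 => Cat (bind f e1) (bind f e2)
  | Star e => Star (bind f e)
  end.

Fixpoint expands (A B : Type) (R : A -> seq B -> Prop) (s : seq A) : seq B -> Prop :=
  if s is a :: s' then catl (R a) (expands R s') else fun w => w = [::].

Lemma expands_cat A B (R : A -> seq B -> Prop) s1 s2 w :
  expands R (s1 ++ s2) w <-> catl (expands R s1) (expands R s2) w.
Proof.
elim: s1 w => [|a s1 IH] w /=.
  by split=> [Rw|[u [v [-> -> //]]]]; exists [::], w.
split=> [[u [v [-> Ru /IH[u' [v' [-> R1 R2]]]]]]|].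
  by exists (u ++ u'), v'; rewrite catA; split=> //; exists u, u'.
case=> _ [v [-> [u [u' [-> Ru R1]]] R2]]; exists u, (u' ++ v); rewrite catA; split=> //.
by apply/IH; exists u', v.
Qed.

(** Every layer of the construction is a substitution: cells become group words, commands become
    rows. This peels off one layer. *)
Lemma lang_bind A B (f : A -> re B) e w :
  lang (bind f e) w <-> exists2 s, lang e s & expands (fun a => lang (f a)) s w.
Proof.
elim: e w => [||a|e1 IH1 e2 IH2|e1 IH1 e2 IH2|e IH] w /=.
- by split=> // -[].
- by split=> [->|[s -> //]]; exists [::].
- split=> [fw|[s -> [u [v [-> fu ->]]]]]; last by rewrite cats0.
  by exists [:: a] => //; exists w, [::]; rewrite cats0.
- split=> [[/IH1[s s1 s2]|/IH2[s s1 s2]]|[s [s1|s1] s2]]; try by exists s; auto.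
    by left; apply/IH1; exists s.
  by right; apply/IH2; exists s.
- split=> [[u [v [-> /IH1[s s1 s2] /IH2[t t1 t2]]]]|].
    by exists (s ++ t); [exists s, t | apply/expands_cat; exists u, v].
  case=> _ [s [t [-> s1 t1]]] /expands_cat[u [v [-> s2 t2]]]; exists u, v; split=> //.
    by apply/IH1; exists s.
  by apply/IH2; exists t.
- split=> [|[s ss]].
    elim=> [|u v /IH[s s1 s2] _ [t t1 t2]]; first by exists [::] => //; constructor.
    by exists (s ++ t); [apply: star_cons | apply/expands_cat; exists u, v].
  elim: ss w => [w ->|s1 s2 es _ IH2 w /expands_cat[u [v [-> R1 R2]]]]; first by constructor.
  by apply: star_cons; [apply/IH; exists s1 | apply: IH2].
Qed.

Fixpoint lit (A : Type) (w : seq A) : re A :=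
  if w is a :: w' then Cat (Sym a) (lit w') else Eps.

Lemma lang_lit A (w u : seq A) : lang (lit w) u <-> u = w.
Proof.
elim: w u => //= a w IH u; split=> [[_ [v [-> -> /IH-> //]]]|->].
by exists [:: a], w; split=> //; apply/IH.
Qed.

Lemma expands_lit A B (f : A -> seq B) s w :
  expands (fun a => lang (lit (f a))) s w <-> w = flatten (map f s).
Proof.
elim: s w => //= a s IH w; split=> [[u [v [-> /lang_lit-> /IH-> //]]]|->].
by exists (f a), (flatten (map f s)); split=> //; [apply/lang_lit | apply/IH].
Qed.

Definition anyp (T : finType) (P : pred T) : re T := foldr (fun a => Alt (Sym a)) Emp (enum P).

Lemma lang_anyp (T : finType) (P : pred T) w :
  lang (anyp P) w <-> exists2 a, P a & w = [:: a].
Proof.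
rewrite /anyp; have -> : (exists2 a, P a & w = [:: a]) <-> (exists2 a, a \in enum P & w = [:: a]).
  by split=> -[a Pa ->]; exists a => //; move: Pa; rewrite mem_enum.
elim: (enum P) w => [|a s IH] w /=; first by split=> // -[].
split=> [[->|]|[b]]; first by exists a => //; rewrite inE eqxx.
  by move/IH=> [b bs ->]; exists b => //; rewrite inE bs orbT.
by rewrite inE => /orP[/eqP->|bs] ->; [left | right; apply/IH; exists b].
Qed.

Lemma lang_all (T : finType) (P : pred T) w : lang (Star (anyp P)) w <-> all P w.
Proof.
split=> /= [|Pw]; first by elim=> // u v /lang_anyp[a Pa ->] _ /= ->; rewrite Pa.
elim: w Pw => [|a w IH] /=; first by constructor.
by case/andP=> Pa /IH sw; apply: (@star_cons _ _ [:: a]) sw; apply/lang_anyp; exists a.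
Qed.

(* A nondeterministic automaton given by the languages [F q] accepted from its states. *)
Definition regular (L : word -> Prop) : Prop :=
  exists (S : finType) (F : S -> word -> Prop) (D : S -> letter -> pred S) (nul : pred S) (s : S),
  [/\ forall w, F s w <-> L w, forall q, F q [::] <-> nul q &
      forall q x w, F q (x :: w) <-> exists2 q', D q x q' & F q' w].

Lemma regular_emp : regular (lang Emp).
Proof.
exists unit, (fun _ _ => False), (fun _ _ _ => false), (fun _ => false), tt.
by split=> //; split=> // -[].
Qed.

Lemma regular_eps : regular (lang Eps).
Proof.
exists unit, (fun _ w => w = [::]), (fun _ _ _ => false), (fun _ => true), tt.
by split=> //; split=> // -[].
Qed.

Lemma letter_eq_dec (x y : letter) : {x = y} + {x <> y}.
Proof. by decide equality. Qed.

Lemma regular_sym a : regular (lang (Sym a)).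
Proof.
exists bool, (fun b w => w = if b then [:: a] else [::]),
  (fun b x b' => [&& b, ~~ b' & is_left (letter_eq_dec x a)]), negb, true.
split=> //; first by case; split.
move=> [] x w /=; last by split=> // -[].
split=> [[-> ->]|[[] //=]]; first by exists false => //=; case: letter_eq_dec.
by case: letter_eq_dec => //= -> _ ->.
Qed.

Lemma regular_alt L1 L2 : regular L1 -> regular L2 -> regular (fun w => L1 w \/ L2 w).
Proof.
move=> [S1 [F1 [D1 [n1 [s1 [Fs1 F01 FS1]]]]]] [S2 [F2 [D2 [n2 [s2 [Fs2 F02 FS2]]]]]].
exists (option (S1 + S2)%type),
  (fun q w => match q with None => L1 w \/ L2 w | Some (inl q) => F1 q w | Some (inr q) => F2 q w end),
  (fun q x q' => match q, q' with
     | None, Some (inl r) => D1 s1 x r | None, Some (inr r) => D2 s2 x r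
     | Some (inl q), Some (inl r) => D1 q x r | Some (inr q), Some (inr r) => D2 q x r
     | _, _ => false end),
  (fun q => match q with None => n1 s1 || n2 s2 | Some (inl q) => n1 q | Some (inr q) => n2 q end), None.
split=> //= [[[q|q]|] //|[[q|q]|] x w].
- by rewrite -Fs1 -Fs2 F01 F02; split=> /orP.
- rewrite FS1; split=> [[r]|[[[r|r]|]]] //; last by exists r.
  by exists (Some (inl r)).
- rewrite FS2; split=> [[r]|[[[r|r]|]]] //; last by exists r.
  by exists (Some (inr r)).
- rewrite -Fs1 -Fs2 FS1 FS2; split=> [[[r]|[r]]|[[[r|r]|]]] //.
  + by exists (Some (inl r)).
  + by exists (Some (inr r)).
  + by left; exists r.
  + by right; exists r.
Qed.

Lemma catl_nil A (L1 L2 : seq A -> Prop) : catl L1 L2 [::] <-> L1 [::] /\ L2 [::].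
Proof. by split=> [[[|? ?] [[|? ?] []]] //|[H1 H2]]; exists [::], [::]. Qed.

Lemma catl_cons A (L1 L2 : seq A -> Prop) x w :
  catl L1 L2 (x :: w) <-> catl (fun u => L1 (x :: u)) L2 w \/ (L1 [::] /\ L2 (x :: w)).
Proof.
split=> [[[|y u] [v [/= eqw H1 H2]]]|[[u [v [-> H1 H2]]]|[H1 H2]]].
- by right; rewrite eqw.
- by case: eqw => -> ->; left; exists u, v.
- by exists (x :: u), v.
- by exists [::], (x :: w).
Qed.

(** There are no silent moves: a state of the first automaton that may stop also takes the moves of
    the start state [s2] of the second. *)
Lemma regular_cat L1 L2 : regular L1 -> regular L2 -> regular (catl L1 L2).
Proof.
move=> [S1 [F1 [D1 [n1 [s1 [Fs1 F01 FS1]]]]]] [S2 [F2 [D2 [n2 [s2 [Fs2 F02 FS2]]]]]].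
exists (S1 + S2)%type,
  (fun q => match q with inl q => catl (F1 q) (F2 s2) | inr q => F2 q end),
  (fun q x q' => match q, q' with
     | inl q, inl r => D1 q x r | inl q, inr r => n1 q && D2 s2 x r
     | inr q, inr r => D2 q x r | _, _ => false end),
  (fun q => match q with inl q => n1 q && n2 s2 | inr q => n2 q end), (inl s1).
split=> [w|[q|q] //|[q|q] x w].
- by split=> -[u [v [-> /Fs1 ? /Fs2 ?]]]; exists u, v.
- by rewrite catl_nil F01 F02; split=> [[-> ->]|/andP].
- rewrite catl_cons FS2; split.
    case=> [[u [v [-> /FS1[r Dr Fr] F2v]]]|[/F01 nq [r Dr Fr]]].
      by exists (inl r) => //; exists u, v.
    by exists (inr r) => //; rewrite nq.
  case=> -[r Dr [u [v [-> Fu Fv]]]|r /andP[/F01 nq Dr] Fr].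
    by left; exists u, v; split=> //; apply/FS1; exists r.
  by right; split=> //; exists r.
- rewrite FS2; split=> [[r]|[[r|r]]] //; last by exists r.
  by exists (inr r).
Qed.

(** [None] is a fresh accepting start state; [Some q] is inside a factor, and when [q] may stop it
    also takes the moves that open the next factor. *)
Lemma regular_star L : regular L -> regular (star L).
Proof.
move=> [S [F [D [n [s [Fs F0 FS]]]]]].
have starE x w : star L (x :: w) <-> exists2 r, D s x r & catl (F r) (star L) w.
  rewrite star_consE; split=> [[u [v [-> /Fs/FS[r Dr Fr] sv]]]|[r Dr [u [v [-> Fr sv]]]]].
    by exists r => //; exists u, v.
  by exists u, v; split=> //; apply/Fs/FS; exists r.
exists (option S),
  (fun q => if q is Some q then catl (F q) (star L) else star L),
  (fun q x r => match q, r with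
     | None, Some r => D s x r | Some q, Some r => D q x r || (n q && D s x r)
     | _, None => false end),
  (fun q => if q is Some q then n q else true), None.
split=> // [[q|]|[q|] x w].
- rewrite catl_nil F0; split=> [[]//|nq]; split=> //; constructor.
- by split=> // _; constructor.
- rewrite catl_cons starE; split.
    case=> [[u [v [-> /FS[r Dr Fr] sv]]]|[/F0 nq [r Dr Fr]]].
      by exists (Some r); [rewrite Dr | exists u, v].
    by exists (Some r) => //; rewrite nq Dr orbT.
  case=> -[r|] // /orP[Dr [u [v [-> Fr sv]]]|/andP[/F0 nq Dr] Fr].
    by left; exists u, v; split=> //; apply/FS; exists r.
  by right; split=> //; exists r.
- rewrite starE; split=> [[r Dr Fr]|[[r|] //]]; last by exists r.
  by exists (Some r).
Qed.

Lemma regular_lang (e : re letter) : regular (lang e).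
Proof.
elim: e => [||a|e1 IH1 e2 IH2|e1 IH1 e2 IH2|e IH].
- exact: regular_emp.
- exact: regular_eps.
- exact: regular_sym.
- exact: regular_alt.
- exact: regular_cat.
- exact: regular_star.
Qed.

(** Subset construction, with [enum_rank] numbering the sets of states. *)
Lemma regular_dfa L : regular L -> exists A : dfa, forall w, dfa_accepts A w <-> L w.
Proof.
move=> [S [F [D [n [s [Fs F0 FS]]]]]].
pose tr (A : {set S}) x := [set r | [exists q in A, D q x r]].
exists (@DFA #|{set S}| (enum_rank [set s])
  (fun i => [exists q in (enum_val i : {set S}), n q])
  (fun i x => enum_rank (tr (enum_val i) x))) => w.
rewrite -Fs /dfa_accepts /=.
have -> : F s w <-> exists2 q, q \in [set s] & F q w.
  by split=> [Fw|[q /set1P-> //]]; exists s => //; apply/set1P.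
elim: w [set s] => [|x w IH] A /=.
  rewrite enum_rankK; split=> [/exists_inP[q qA nq]|[q qA /F0 nq]]; last by apply/exists_inP; exists q.
  by exists q => //; apply/F0.
rewrite enum_rankK IH; split=> [[r]|[q qA /FS[r Dr Fr]]].
  by rewrite inE => /exists_inP[q qA Dr] Fr; exists q => //; apply/FS; exists r.
by exists r => //; rewrite inE; apply/exists_inP; exists q.
Qed.

(** * Lamps along a path *)

Section Lamps.
Variable n : nat.
Local Open Scope ring_scope.

Definition move (p : pt) (x : letter) : pt := ptadd p (gen n x).2.
Definition pos (p : pt) (u : word) : pt := foldl move p u.

Definition toggle (x : letter) : 'Z_n := match x with La => 1 | LaI => -1 | _ => 0 end.

Fixpoint lamp (u : word) (p q : pt) : 'Z_n :=
  if u is x :: u' then (if q == p then toggle x else 0) + lamp u' (move p x) q else 0.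

Lemma ptadd0 p : ptadd p (0, 0) = p.
Proof. by case: p => a b; rewrite /ptadd /= !addr0. Qed.

Lemma ptadd_assoc p q r : ptadd (ptadd p q) r = ptadd p (ptadd q r).
Proof. by rewrite /ptadd /= !addrA. Qed.

Lemma piw_pos u p : pos p u = ptadd p (piw n u).2.
Proof.
elim: u p => [|x u IH] p /=; first by rewrite ptadd0.
by rewrite IH /move ptadd_assoc.
Qed.

(** The product translates the second factor by the first cursor, so a coefficient taken relative to
    [p] sums the toggles made while the cursor stands at [q]. *)
Lemma piw_lamp u p q : (piw n u).1 (ptsub q p) = lamp u p q.
Proof.
elim: u p => //= x u IH p; rewrite -IH; congr (_ + (piw n u).1 _); last first.
  by rewrite /move /ptsub /ptadd /= !opprD !addrA.
have -> : (q == p) = ((ptsub q p).1 == 0) && ((ptsub q p).2 == 0).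
  by rewrite /ptsub /= !subr_eq0 -xpair_eqE -!surjective_pairing.
by case: x => //=; rewrite /delta0; case: ifP.
Qed.

Lemma pos_cat p u v : pos p (u ++ v) = pos (pos p u) v.
Proof. exact: foldl_cat. Qed.

Lemma lamp_cat u v p q : lamp (u ++ v) p q = lamp u p q + lamp v (pos p u) q.
Proof. by elim: u p => [|x u IH] p /=; rewrite ?add0r // IH addrA. Qed.

Lemma pos_nseq k x p : pos p (nseq k x) = (p.1 + (gen n x).2.1 *+ k, p.2 + (gen n x).2.2 *+ k).
Proof.
elim: k p => [|k IH] p /=; first by rewrite !mulr0n !addr0; case: p.
by rewrite IH /move /ptadd /= !mulrS !addrA.
Qed.

Lemma lamp_nseq0 k x p q : toggle x = 0 -> lamp (nseq k x) p q = 0.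
Proof. by move=> x0; elim: k p => //= k IH p; rewrite IH x0 if_same addr0. Qed.

Definition ind (b : bool) : 'Z_n := b%:R.

(** Rests on 1 <> 0 in ['Z_n]. For n = 2 writing and erasing are the same toggle, and this
    separation is still enough. *)
Lemma ind_inj b1 b2 : ind b1 = ind b2 -> b1 = b2.
Proof. by case: b1 b2 => [] [] //= /eqP; rewrite /ind ?oner_eq0 // eq_sym oner_eq0. Qed.

Definition put (l : letter) (h : nat) : word := nseq h Ls ++ l :: nseq h LsI.

Lemma pos_put l h p : l = La \/ l = LaI -> pos p (put l h) = p.
Proof.
case: p => x y [] ->; rewrite pos_cat /= !pos_nseq /move /ptadd /= !mul0rn !addr0;
  by congr (_, _); rewrite mulNrn addrK.
Qed.

Lemma lamp_put l h p q : l = La \/ l = LaI ->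
  lamp (put l h) p q = if q == (p.1, p.2 + h%:Z) then toggle l else 0.
Proof.
move=> ll; rewrite lamp_cat lamp_nseq0 // add0r /= lamp_nseq0 // addr0 pos_nseq /=.
by rewrite mul0rn addr0 natz.
Qed.

Variable H : nat.

(* A cell carries the south colour that a visit erases and the north colour that it writes. *)
Definition cell := (option nat * option nat)%type.
Definition put_opt (l : letter) (h : nat) (o : option nat) : word :=
  if o is Some c then put l (h + c) else [::].
Definition cell_word (c : cell) : word := put_opt LaI 0 c.1 ++ put_opt La H c.2 ++ [:: Lt].
Definition cells_word (cs : seq cell) : word := flatten (map cell_word cs).
(* How far to walk left is guessed; only the return to the first column lets the lamps cancel. *)
Definition newline (b : nat) : word := nseq b LtI ++ nseq H Ls.
Definition row_word (r : nat * seq cell) : word := newline r.1 ++ cells_word r.2.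
Definition rows_word (rs : seq (nat * seq cell)) : word := flatten (map row_word rs).

Definition hit1 (o : option nat) (a y : int) (q : pt) : bool :=
  if o is Some c then q == (a, y + c%:Z) else false.
Fixpoint hit (l : seq (option nat)) (a y : int) (q : pt) : bool :=
  if l is o :: l' then hit1 o a y q || hit l' (a + 1) y q else false.

Lemma hit_ge l a y q : hit l a y q -> a <= q.1.
Proof.
elim: l a => //= o l IH a /orP[|/IH]; last by lia.
by case: o => //= c /eqP->.
Qed.

Lemma hit_band l a y q : all (fun o => if o is Some c then (c < H)%N else true) l ->
  hit l a y q -> y <= q.2 < y + H%:Z.
Proof.
elim: l a => //= o l IH a /andP[oH /IH{}IH] /orP[|/IH //].
by case: o oH => //= c cH /eqP-> /=; lia.
Qed.

Lemma hit_low l a y q : hit l a y q -> y <= q.2.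
Proof.
elim: l a => //= o l IH a /orP[|/IH //].
by case: o => //= c /eqP-> /=; lia.
Qed.

Lemma hit_shift l a y q : hit l a y q = hit l a 0 (q.1, q.2 - y).
Proof.
elim: l a => //= o l IH a; rewrite IH; congr (_ || _).
case: o => //= c; case: q {IH} => u v; rewrite !xpair_eqE /=; congr (_ && _).
by rewrite add0r subr_eq addrC.
Qed.

(** A letter can be read back from its picture, because the columns of the tail never reach column
    [a] ([hit_ge]). *)
Lemma hit_nth l a i c : hit l a 0 (a + i%:Z, c%:Z) = (nth None l i == Some c).
Proof.
elim: l a i => [|o l IH] a [|i] //=.
  rewrite addr0; have -> : hit l (a + 1) 0 (a, c%:Z) = false.
    by apply/negP => /hit_ge /=; lia.
  by rewrite orbF; case: o => //= d; rewrite xpair_eqE eqxx /= add0r eq_sym.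
have -> : hit1 o a 0 (a + i.+1%:Z, c%:Z) = false.
  by case: o => //= d; rewrite xpair_eqE; apply/negP => /andP[/eqP]; lia.
by rewrite /= -(IH (a + 1)); congr (hit _ _ _ (_, _)); lia.
Qed.

(** Without blanks the first column of a nonempty picture is occupied, so [hit_ge] used both ways
    gives [a = b], and the letters are read off. This is what punishes a wrong walk back to the
    first column. *)
Lemma hit_inj l1 l2 a b : hit (map Some l1) a 0 =1 hit (map Some l2) b 0 -> l1 = l2.
Proof.
move=> hh.
have hd (l : seq nat) (c : int) : l <> [::] -> hit (map Some l) c 0 (c, (head 0%N l)%:Z).
  case: l => // d l _; have := hit_nth (map Some (d :: l)) c 0 d.
  by rewrite addr0 => ->; apply: eqxx.
have [l10|/eqP l1n] := eqVneq l1 [::].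
  have [l20|/eqP l2n] := eqVneq l2 [::]; first by rewrite l10.
  by have := hh (b, (head 0%N l2)%:Z); rewrite hd // l10.
have [l20|/eqP l2n] := eqVneq l2 [::].
  by have := hh (a, (head 0%N l1)%:Z); rewrite hd // l20.
have eab : a = b.
  have /hit_ge /= h1 : hit (map Some l2) b 0 (a, (head 0%N l1)%:Z) by rewrite -hh hd.
  have /hit_ge /= h2 : hit (map Some l1) a 0 (b, (head 0%N l2)%:Z) by rewrite hh hd.
  by lia.
subst b; suff : map Some l1 = map Some l2 by move/(inj_map (@Some_inj _)).
have nthE i : nth None (map Some l1) i = nth None (map Some l2) i.
  case E1 : (nth None (map Some l1) i) => [c|].
    by apply/esym/eqP; rewrite -(hit_nth _ a) -hh hit_nth E1.
  case E2 : (nth None (map Some l2) i) => [c|//].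
  by move/eqP: E2; rewrite -(hit_nth _ a) -hh hit_nth E1.
(* A list reads [None] past its end, while a longer list without blanks still has a [Some] there. *)
have szle (l l' : seq nat) : (forall i, nth None (map Some l) i = nth None (map Some l') i) ->
    (size l <= size l')%N.
  move=> e; rewrite leqNgt; apply/negP => lt; have := e (size l').
  by rewrite (nth_map 0%N) // [RHS]nth_default // size_map.
have szE : size l1 = size l2 by apply/eqP; rewrite eqn_leq !szle // => i; rewrite nthE.
by apply: (@eq_from_nth _ None) => [|i _]; rewrite ?size_map.
Qed.

(** * Lamps of rows and their cancellation *)

Lemma pos_put_opt l h o p : l = La \/ l = LaI -> pos p (put_opt l h o) = p.
Proof. by case: o => //= d; apply: pos_put. Qed.

Lemma pos_cell c p : pos p (cell_word c) = (p.1 + 1, p.2).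
Proof.
by rewrite !pos_cat !pos_put_opt; auto; rewrite /= /move /ptadd /= addr0.
Qed.

Lemma pos_cells cs p : pos p (cells_word cs) = (p.1 + (size cs)%:Z, p.2).
Proof.
elim: cs p => [|c cs IH] p /=; first by rewrite addr0; case: p.
by rewrite /cells_word /= pos_cat pos_cell IH /=; congr (_, _); lia.
Qed.

Lemma lamp_put_opt l h o p q : l = La \/ l = LaI ->
  lamp (put_opt l h o) p q = if hit1 o p.1 (p.2 + h%:Z) q then toggle l else 0.
Proof. by case: o => //= c ll; rewrite lamp_put // PoszD addrA. Qed.

Lemma lamp_cell c p q : lamp (cell_word c) p q =
  ind (hit1 c.2 p.1 (p.2 + H%:Z) q) - ind (hit1 c.1 p.1 p.2 q).
Proof.
rewrite !lamp_cat !lamp_put_opt ?pos_put_opt /=; auto.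
rewrite if_same !addr0 addrC /ind; do 2!case: hit1; rewrite /= ?subr0 ?sub0r ?addr0 ?add0r //.
Qed.

Lemma lamp_cells cs a y q : lamp (cells_word cs) (a, y) q =
  ind (hit (map snd cs) a (y + H%:Z) q) - ind (hit (map fst cs) a y q).
Proof.
(* The picture of the tail starts one column further, so no lamp is counted twice and the modulus
   cannot hide multiplicities. *)
have indU o l b z : ind (hit1 o b z q || hit l (b + 1) z q) = ind (hit1 o b z q) + ind (hit l (b + 1) z q).
  case h1 : hit1; case h2 : hit; rewrite /ind /= ?addr0 ?add0r //.
  by move/hit_ge: h2; case: o h1 => //= c /eqP-> /=; lia.
elim: cs a => [|c cs IH] a /=; first by rewrite subrr.
by rewrite /cells_word /= lamp_cat lamp_cell pos_cell IH !indU /=; ring.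
Qed.

Lemma pos_newline b p : pos p (newline b) = (p.1 - b%:Z, p.2 + H%:Z).
Proof. by rewrite pos_cat !pos_nseq /= !mul0rn !addr0 mulNrn !natz. Qed.

Lemma lamp_row b cs x y q : lamp (row_word (b, cs)) (x, y) q =
  ind (hit (map snd cs) (x - b%:Z) (y + H%:Z + H%:Z) q) - ind (hit (map fst cs) (x - b%:Z) (y + H%:Z) q).
Proof.
by rewrite /row_word lamp_cat pos_newline lamp_cells /newline lamp_cat !lamp_nseq0 // !add0r.
Qed.

Lemma pos_row b cs x y :
  pos (x, y) (row_word (b, cs)) = (x - b%:Z + (size cs)%:Z, y + H%:Z).
Proof. by rewrite pos_cat pos_newline pos_cells. Qed.

(** A row climbs [H] before it touches a lamp, and the later rows start even higher. *)
Lemma lamp_rows_low rs x y q : q.2 < y + H%:Z -> lamp (rows_word rs) (x, y) q = 0.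
Proof.
elim: rs x y => //= -[b cs] rs IH x y lt.
rewrite /rows_word /= lamp_cat lamp_row pos_row IH; last by lia.
case h1 : hit; first by move/hit_low: h1; lia.
by case h2 : hit; [move/hit_low: h2; lia | rewrite subrr addr0].
Qed.

Definition coded (l : seq (option nat)) : bool :=
  all (fun o => if o is Some c then (c < H)%N else true) l.

(** [N] is the word written last and not yet erased, [a] its first column and [x] the column of the
    cursor. Pictures are compared rather than words, since [mark k] has blanks and the walk back [b]
    is not yet known to be right. *)
Fixpoint chained (N : seq (option nat)) (a x : int) (rs : seq (nat * seq cell)) : Prop :=
  if rs is (b, cs) :: rs' then
    hit N a 0 =1 hit (map fst cs) (x - b%:Z) 0 /\
    chained (map snd cs) (x - b%:Z) (x - b%:Z + (size cs)%:Z) rs'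
  else hit N a 0 =1 xpred0.

(** Induction on the rows, with the lowest unsettled band at height [y + H]. Only the pending word
    and the erasing half of the first row reach it, so it balances on its own; the half written one
    band higher then becomes the pending word. *)
Lemma chainedP N a x y rs : coded N ->
  all (fun r => coded (map fst r.2) && coded (map snd r.2)) rs ->
  (forall q, ind (hit N a (y + H%:Z) q) + lamp (rows_word rs) (x, y) q = 0) <-> chained N a x rs.
Proof.
elim: rs N a x y => [|[b cs] rs IH] N a x y cN.
  move=> _ /=; split=> [h q|h q]; last by rewrite hit_shift h addr0.
  have := h (q.1, q.2 + (y + H%:Z)); rewrite addr0 hit_shift /= addrK -surjective_pairing.
  by move/(@ind_inj _ false).
rewrite [all _ _]/= => /andP[/andP[cf cs2] crs].
have lE q : lamp (rows_word ((b, cs) :: rs)) (x, y) q =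
    ind (hit (map snd cs) (x - b%:Z) (y + H%:Z + H%:Z) q) - ind (hit (map fst cs) (x - b%:Z) (y + H%:Z) q)
    + lamp (rows_word rs) (x - b%:Z + (size cs)%:Z, y + H%:Z) q.
  by rewrite /rows_word /= lamp_cat lamp_row pos_row.
rewrite [chained _ _ _ _]/= -(IH _ _ _ (y + H%:Z)) //.
split=> [h|[h1 h2] q]; last first.
  rewrite lE -(h2 q) hit_shift h1 -hit_shift; ring.
(* Below the next band the later rows and the writing half of this row contribute nothing; two
   indicators remain. *)
have low q : q.2 < y + H%:Z + H%:Z ->
    hit N a (y + H%:Z) q = hit (map fst cs) (x - b%:Z) (y + H%:Z) q.
  move=> lt; apply: (@ind_inj); apply/eqP; rewrite -subr_eq0 -[X in _ == X](h q) lE lamp_rows_low //.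
  case h2 : (hit (map snd cs) _ _ _); first by have := hit_low h2; rewrite leNgt lt.
  by apply/eqP; rewrite [ind false]/(ind _) /=; ring.
(* From the next band on both pictures are empty, by [hit_band] and the bound on the codes. *)
have hE q : hit N a (y + H%:Z) q = hit (map fst cs) (x - b%:Z) (y + H%:Z) q.
  case: (ltP q.2 (y + H%:Z + H%:Z)) => [/low //|ge].
  case h1 : hit; first by have := hit_band cN h1; lia.
  by case h2 : hit => //; have := hit_band cf h2; lia.
split=> q; last by rewrite -(h q) lE hE; ring.
by have := hE (q.1, q.2 + (y + H%:Z)); rewrite hit_shift [in RHS]hit_shift /= addrK -surjective_pairing.
Qed.

End Lamps.

(** * Iterated transducers *)

Definition walk : re letter := Star (Alt (Alt (Sym Lt) (Sym LtI)) (Alt (Sym Ls) (Sym LsI))).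

Lemma lamp_walk n w p q : lang walk w -> lamp n w p q = 0%R.
Proof.
move=> sw; elim: sw p => //= u v Lu _ IH p.
by case: Lu => -[] -> /=; rewrite if_same add0r IH.
Qed.

Lemma walk_nseq k x : [\/ x = Lt, x = LtI, x = Ls | x = LsI] -> lang walk (nseq k x).
Proof.
move=> hx; elim: k => [|k IH]; first by constructor.
rewrite -[nseq _ _]/([:: x] ++ nseq k x); apply: star_cons IH => /=.
by case: hx => ->; auto.
Qed.

(** Equality in the group also fixes the end of the path. A final walk without toggles corrects it,
    so that only the lamps constrain a run. *)
Lemma walk_reach n (p p' : pt) : exists2 w, lang walk w & pos n p w = p'.
Proof.
have step (d : int) x y : [\/ x = Lt, x = LtI, x = Ls | x = LsI] -> [\/ y = Lt, y = LtI, y = Ls | y = LsI] ->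
    exists2 w, lang walk w & exists i j : nat, (i%:Z - j%:Z)%R = d /\ w = nseq i x ++ nseq j y.
  move=> hx hy; have [i [j ij]] : exists i j : nat, (i%:Z - j%:Z = d)%R.
    by case: d => d; [exists d, 0 | exists 0, d.+1]; lia.
  by exists (nseq i x ++ nseq j y); [apply: star_cat; apply: walk_nseq | exists i, j].
have [w sw [i [j [ij ew]]]] := step (p'.1 - p.1)%R Lt LtI (Or41 _ _ _ erefl) (Or42 _ _ _ erefl).
have [v sv [i' [j' [ij' ev]]]] := step (p'.2 - p.2)%R Ls LsI (Or43 _ _ _ erefl) (Or44 _ _ _ erefl).
exists (w ++ v); first exact: star_cat.
rewrite ew ev !pos_cat !pos_nseq /= !mul0rn !mulNrn !natz; case: p' p ij ij' {ew ev} => a b [c d] /= ij ij'.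
by congr (_, _); lia.
Qed.

Definition target (k : nat) : word := nseq k Lt ++ [:: LaI].
Definition mark (k : nat) : seq (option nat) := nseq k None ++ [:: Some 0].

(** Trailing blanks leave no trace, so words of different lengths can share a picture: [mark k] ends
    at [k], while the initial row may go on. *)
Lemma hit_ext l l' a : (forall i, nth None l i = nth None l' i) -> hit l a 0 =1 hit l' a 0.
Proof.
move=> e [u v]; have [ua|au] := ltP u a.
  by case h: hit; [move/hit_ge: h => /=; lia | case h': hit => //; move/hit_ge: h' => /=; lia].
have [v0|v0] := ltP v 0%R.
  by case h: hit; [move/hit_low: h => /=; lia | case h': hit => //; move/hit_low: h' => /=; lia].
have [[i ->] [c ->]] : (exists i : nat, u = a + i%:Z)%R /\ exists c : nat, v = Posz c.
  by split; [exists `|u - a|%N | exists `|v|%N]; lia.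
by rewrite !hit_nth e.
Qed.

Lemma nth_mark k i : nth None (mark k) i = if i == k then Some 0 else None.
Proof.
rewrite nth_cat size_nseq nth_nseq; case: ltngtP => // ik; last by rewrite ik subnn.
by case: (i - k) (subn_gt0 k i) => [|[]] //; rewrite ik.
Qed.

Lemma lamp_target n k q : lamp n (target k) (0%R, 0%R) q = (- ind n (hit (mark k) 0 0 q))%R.
Proof.
rewrite lamp_cat lamp_nseq0 // add0r pos_nseq /= mul0rn addr0 add0r natz addr0.
suff -> : hit (mark k) 0 0 q = (q == (Posz k, 0%R)) by case: eqP; rewrite /ind ?oppr0.
have hitE (a : int) : hit (mark k) a 0 q = (q == (a + k%:Z, 0)%R).
  elim: k a => [|k IH] a /=; first by rewrite /mark /= orbF !addr0.
  by rewrite /mark /= -/(mark k) IH; congr (q == (_, _)); lia.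
by rewrite hitE add0r.
Qed.

Section Transducer.
Variables (G : finType) (g0 : G) (C : Type).
Variables (row : C -> re (G * G)) (prog : re C) (init : re (bool * G)).

Let H := #|G|.
Definition code (c : G) : nat := enum_rank c.
Definition init_cell (x : bool * G) : cell := (if x.1 then Some 0 else None, Some (code x.2)).
Definition step_cell (x : G * G) : cell := (Some (code x.1), Some (code x.2)).
Definition final_cell (x : G) : cell := (Some (code x), None).

Definition cells_re (A : Type) (f : A -> cell) (e : re A) : re letter :=
  bind (fun a => lit (cell_word H (f a))) e.
Definition newline_re : re letter := Cat (Star (Sym LtI)) (lit (nseq H Ls)).
Definition command_re (c : C) : re letter := Cat newline_re (cells_re step_cell (row c)).
(** The last row erases the final word and writes nothing, so that no lamp remains; [walk] then
    frees the end point. *)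
Definition path_re : re letter :=
  Cat (cells_re init_cell init)
    (Cat (bind command_re prog)
      (Cat (Cat newline_re (cells_re final_cell (Star (anyp predT)))) walk)).

Fixpoint runs (cs : seq C) (s s' : seq G) : Prop :=
  if cs is c :: cs' then
    exists ps, [/\ lang (row c) ps, unzip1 ps = s & runs cs' (unzip2 ps) s']
  else s = s'.

Lemma lang_cells (A : Type) (f : A -> cell) e w :
  lang (cells_re f e) w <-> exists2 s, lang e s & w = cells_word H (map f s).
Proof.
rewrite lang_bind; split=> -[s Ls]; last first.
  by move=> ->; exists s => //; apply/expands_lit; rewrite /cells_word -map_comp.
by move/expands_lit=> ->; exists s => //; rewrite /cells_word -map_comp.
Qed.

Lemma lang_newline w : lang newline_re w <-> exists b, w = newline H b.
Proof.
split=> [[u [v [-> su /lang_lit->]]]|[b ->]].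
  suff [b ->] : exists b, u = nseq b LtI by exists b.
  by elim: su => [|u' v' -> _ [b ->]]; [exists 0 | exists b.+1].
exists (nseq b LtI), (nseq H Ls); split=> //; last exact/lang_lit.
by elim: b => [|b IH]; [constructor | apply: (@star_cons _ _ [:: LtI])].
Qed.

Fixpoint rows_of (cs : seq C) (bps : seq (nat * seq (G * G))) : Prop :=
  match cs, bps with
  | [::], [::] => True
  | c :: cs, bp :: bps => lang (row c) bp.2 /\ rows_of cs bps
  | _, _ => False
  end.

Definition step_row (bp : nat * seq (G * G)) : nat * seq cell := (bp.1, map step_cell bp.2).

Lemma expands_command cs w :
  expands (fun c => lang (command_re c)) cs w <->
  exists2 bps, rows_of cs bps & w = rows_word H (map step_row bps).
Proof.
elim: cs w => [|c cs IH] w /=.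
  by split=> [->|[[|//] _ ->]] //; exists [::].
split=> [[_ [v [-> [u1 [u2 [-> /lang_newline[b ->]]]]]]]|].
  case/lang_cells=> ps Lps -> /IH[bps rbps ->].
  by exists ((b, ps) :: bps).
case=> -[|[b ps] bps] //= [Lps rbps] ->.
exists (row_word H (b, map step_cell ps)), (rows_word H (map step_row bps)); split=> //; last by apply/IH; exists bps.
exists (newline H b), (cells_word H (map step_cell ps)); split=> //; first by apply/lang_newline; exists b.
by apply/lang_cells; exists ps.
Qed.

Lemma code_inj : injective code.
Proof. by move=> c d /val_inj/enum_rank_inj. Qed.

Lemma code_lt c : code c < H.
Proof. exact: ltn_ord. Qed.

Definition colours (s : seq G) : seq (option nat) := map Some (map code s).

Lemma fst_init ms : map fst (map init_cell ms) = [seq if b then Some 0 else None | b <- unzip1 ms].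
Proof. by rewrite -!map_comp. Qed.
Lemma snd_init ms : map snd (map init_cell ms) = colours (unzip2 ms).
Proof. by rewrite /colours -!map_comp. Qed.
Lemma fst_step ps : map fst (map step_cell ps) = colours (unzip1 ps).
Proof. by rewrite /colours -!map_comp. Qed.
Lemma snd_step ps : map snd (map step_cell ps) = colours (unzip2 ps).
Proof. by rewrite /colours -!map_comp. Qed.
Lemma fst_final s : map fst (map final_cell s) = colours s.
Proof. by rewrite /colours -!map_comp. Qed.
Lemma snd_final s : map snd (map final_cell s) = nseq (size s) None.
Proof. by elim: s => //= c s ->. Qed.

Lemma coded_colours s : coded H (colours s).
Proof. by elim: s => //= c s ->; rewrite code_lt. Qed.

Lemma coded_rows ms bps b f :
  all (fun r => coded H (map fst r.2) && coded H (map snd r.2))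
    ((0, map init_cell ms) :: map step_row bps ++ [:: (b, map final_cell f)]).
Proof.
have H0 : 0 < H by apply/card_gt0P; exists g0.
rewrite /= all_cat /= fst_init snd_init fst_final snd_final !coded_colours !andbT.
apply/and3P; split; last by rewrite /coded all_nseq orbT.
  by rewrite /coded all_map; apply/allP => -[].
by rewrite all_map; apply/allP => bp _ /=; rewrite fst_step snd_step !coded_colours.
Qed.

Lemma chained_runs cs bps b f s a x : rows_of cs bps ->
  chained (colours s) a x (map step_row bps ++ [:: (b, map final_cell f)]) ->
  exists s', runs cs s s'.
Proof.
elim: cs bps s a x => [|c cs IH] [|[d ps] bps] s a x //=; first by exists s.
case=> Lps rbps; rewrite fst_step snd_step => -[/hit_inj/(inj_map code_inj) es ch].
by have [s' rs'] := IH _ _ _ _ rbps ch; exists s', ps.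
Qed.

(** The honest choice: every walk back has the length of the word, so all rows begin in column 0. *)
Lemma runs_chained cs s s' : runs cs s s' ->
  exists2 bps, rows_of cs bps & chained (colours s) 0 (Posz (size s))
    (map step_row bps ++ [:: (size s, map final_cell s')]).
Proof.
elim: cs s => [s -> |c cs IH s /= [ps [Lps es /IH[bps rbps ch]]]].
  exists [::] => //=; rewrite fst_final snd_final subrr; split=> // q.
  by rewrite (@hit_ext _ [::]) // => i; rewrite nth_nseq if_same nth_nil.
have sz : size ps = size s by rewrite -es size_map.
exists ((size s, ps) :: bps) => //=; rewrite subrr fst_step es; split=> //.
by rewrite snd_step add0r size_map sz; move: ch; rewrite size_map sz.
Qed.

Lemma mark_init k bs : hit (mark k) 0 0 =1 hit [seq if b then Some 0 else None | b <- bs] 0 0 <->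
  forall i, nth false bs i = (i == k).
Proof.
have nthE i : nth None [seq if b then Some 0 else None | b <- bs] i =
    if nth false bs i then Some 0 else None :> option nat.
  by elim: bs i => [|b bs IH] [|i] //=; apply: IH.
split=> [h i|h]; last by apply: hit_ext => i; rewrite nth_mark nthE h.
have := h (0 + i%:Z, 0%:Z)%R; rewrite !hit_nth nth_mark nthE.
by case: (i == k); case: (nth _ _ _).
Qed.

Lemma lang_path u : lang path_re u <->
  exists ms cs bps b f v, [/\ lang init ms, lang prog cs, rows_of cs bps, lang walk v &
    u = cells_word H (map init_cell ms) ++
        rows_word H (map step_row bps ++ [:: (b, map final_cell f)]) ++ v].
Proof.
have rowsE bps b f : rows_word H (map step_row bps ++ [:: (b, map final_cell f)]) =
    rows_word H (map step_row bps) ++ newline H b ++ cells_word H (map final_cell f).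
  by rewrite /rows_word map_cat flatten_cat /= cats0.
split.
  case=> w1 [w2 [-> /lang_cells[ms Lms ->] [w3 [w4 [-> /lang_bind[cs Lcs]]]]]].
  case/expands_command=> bps rbps -> [w5 [v [-> [w6 [w7 [-> /lang_newline[b ->] Lf]]] Lv]]].
  have /lang_cells[f _ ->] : lang (cells_re final_cell (Star (anyp predT))) w7 := Lf.
  by exists ms, cs, bps, b, f, v; rewrite rowsE -!catA.
case=> ms [cs [bps [b [f [v [Lms Lcs rbps Lv ->]]]]]].
exists (cells_word H (map init_cell ms)),
  (rows_word H (map step_row bps) ++ (newline H b ++ cells_word H (map final_cell f)) ++ v).
split; [by rewrite rowsE -!catA | by apply/lang_cells; exists ms |].
exists (rows_word H (map step_row bps)), ((newline H b ++ cells_word H (map final_cell f)) ++ v); split=> //.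
  by apply/lang_bind; exists cs => //; apply/expands_command; exists bps.
exists (newline H b ++ cells_word H (map final_cell f)), v; split=> //.
exists (newline H b), (cells_word H (map final_cell f)); split=> //.
  by apply/lang_newline; exists b.
by apply/lang_cells; exists f => //; apply/lang_all/allP.
Qed.

(** The lamp of the target, moved to the other side of the equation, acts as a word [mark k] already
    written at height 0, which the first row has to erase. *)
Lemma weq_target n u k : weq (piw n u) (piw n (target k)) <->
  (forall q, ind n (hit (mark k) 0 0 q) + lamp n u (0, 0) q = 0)%R /\
  pos n (0, 0)%R u = pos n (0, 0)%R (target k).
Proof.
have q0 (q : pt) : ptsub q (0, 0)%R = q by case: q => ? ?; rewrite /ptsub /= !subr0.
have p0 v : pos n (0, 0)%R v = (piw n v).2.
  by rewrite piw_pos /ptadd /= !add0r; case: (piw n v).2.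
rewrite !p0 /weq; split=> -[h1 h2]; split=> // q.
  by rewrite -piw_lamp q0 h1 -{2}(q0 q) piw_lamp lamp_target subrr.
move: (h1 q) => /eqP; rewrite addrC addr_eq0 => /eqP.
by rewrite -lamp_target -!piw_lamp q0.
Qed.

Theorem transducer_rat n : exists A : dfa, forall k,
  rat_mem n A (target k) <->
  exists ms cs s', [/\ lang init ms, forall i, nth false (unzip1 ms) i = (i == k),
    lang prog cs & runs cs (unzip2 ms) s'].
Proof.
have [A AE] := regular_dfa (regular_lang path_re).
exists A => k.
have key ms bps b f v : lang walk v ->
  (forall q, ind n (hit (mark k) 0 0 q) + lamp n (cells_word H (map init_cell ms) ++
      rows_word H (map step_row bps ++ [:: (b, map final_cell f)]) ++ v) (0, 0) q = 0)%R <->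
  (forall i, nth false (unzip1 ms) i = (i == k)) /\
  chained (colours (unzip2 ms)) 0 (Posz (size ms)) (map step_row bps ++ [:: (b, map final_cell f)]).
  move=> Lv; set rs := map step_row bps ++ _.
  have H0 : 0 < H by apply/card_gt0P; exists g0.
  have cm : coded H (mark k) by rewrite /coded all_cat all_nseq /= H0 orbT.
  (* The initial row has no [newline]; started one band lower, at height [- H], it becomes an
     ordinary row with walk back 0. *)
  have := @chainedP n H (mark k) 0 0 (- H%:Z)%R _ cm (coded_rows ms bps b f).
  rewrite /= subr0 add0r size_map fst_init snd_init mark_init => <-.
  have lE q : lamp n (cells_word H (map init_cell ms) ++ rows_word H rs ++ v) (0, 0)%R q =
      lamp n (rows_word H ((0, map init_cell ms) :: rs)) (0, - H%:Z)%R q.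
    rewrite /rows_word /= lamp_cat -/(rows_word H rs) [in RHS]/row_word -catA [RHS]lamp_cat.
    rewrite lamp_nseq0 // add0r pos_nseq /= mul0rn addr0 natz addNr.
    by rewrite !lamp_cat [lamp n v _ _]lamp_walk // addr0.
  by split=> h q; have := h q; rewrite addNr lE.
split.
  case=> u [/AE/lang_path[ms [cs [bps [b [f [v [Lms Lcs rbps Lv ->]]]]]]]].
  case/weq_target=> /(key _ _ _ _ _ Lv)[mk ch] _.
  by have [s' rs'] := chained_runs rbps ch; exists ms, cs, s'.
case=> ms [cs [s' [Lms mk Lcs /runs_chained[bps rbps]]]]; rewrite size_map => ch.
set w := cells_word H (map init_cell ms) ++
  rows_word H (map step_row bps ++ [:: (size ms, map final_cell s')]).
have [v Lv vE] := walk_reach n (pos n (0, 0)%R w) (pos n (0, 0)%R (target k)).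
exists (w ++ v); split.
  by apply/AE/lang_path; exists ms, cs, bps, (size ms), s', v; rewrite catA.
by apply/weq_target; rewrite pos_cat; split=> //; rewrite -catA; apply/key.
Qed.

End Transducer.

(** * Bounded registers *)

Section Registers.
Variable V : finType.

(** Commands neither jump nor branch: a test blocks when it fails, and choices and loops come from
    the regular expression over commands. *)
Inductive cmd := Zero (r : V) | Inc (r : V) | Equal (r r' : V) | Member (b : bool) (r : V).

Definition store := {ffun V -> nat}.
Definition upd (s : store) (r : V) (v : nat) : store := [ffun x => if x == r then v else s x].

Definition csem (N : nat) (X : nat -> bool) (c : cmd) (s s' : store) : Prop :=
  match c with
  | Zero r => s' = upd s r 0
  | Inc r => s r < N /\ s' = upd s r (s r).+1
  | Equal r r' => s r = s r' /\ s' = s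
  | Member b r => X (s r) = b /\ s' = s
  end.

Definition bounded (N : nat) (s : store) : Prop := forall r, s r <= N.

Lemma csem_bounded N X c s s' : csem N X c s s' -> bounded N s -> bounded N s'.
Proof.
case: c => [r ->|r [lt ->]|r r' [_ ->]|b r [_ ->]] // bs x; rewrite ffunE; case: eqP => // _.
Qed.

Definition column := (bool * {set V})%type.

Definition col (X : nat -> bool) (s : store) (i : nat) : column := (X i, [set r | s r == i]).
Definition tape (N : nat) (X : nat -> bool) (s : store) : seq column := map (col X s) (iota 0 N.+1).

Definition keep (phi : pred column) : pred (column * column) := fun q => (q.2 == q.1) && phi q.1.
Definition cset (r : V) (c : column) : column := (c.1, r |: c.2).
Definition cdel (r : V) (c : column) : column := (c.1, c.2 :\ r).
Definition maps (f : column -> column) : pred (column * column) := fun q => q.2 == f q.1.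

(** On a tape every register marks exactly one column. Hence an increment moves a mark to the
    adjacent column, which the last column does not have, and two registers are equal when their
    marks agree column by column. No row changes the bit of [X]. *)
Definition crow (c : cmd) : re (column * column) :=
  match c with
  | Zero r => Cat (anyp (maps (cset r))) (Star (anyp (maps (cdel r))))
  | Inc r =>
      let id := Star (anyp (keep (fun c => r \notin c.2))) in
      let leave := anyp (fun q : column * column => (r \in q.1.2) && maps (cdel r) q) in
      Cat id (Cat leave (Cat (anyp (maps (cset r))) id))
  | Equal r r' => Star (anyp (keep (fun c => (r \in c.2) == (r' \in c.2))))
  | Member b r => Star (anyp (keep (fun c => (r \in c.2) ==> (c.1 == b))))
  end.

Lemma all_maps f ps : all (maps f) ps <-> unzip2 ps = map f (unzip1 ps).
Proof.
elim: ps => //= q ps IH; split=> [/andP[/eqP-> /IH->] //|[h1 h2]].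
by rewrite /maps h1 eqxx /=; apply/IH.
Qed.

Lemma all_keep phi ps : all (keep phi) ps <-> unzip2 ps = unzip1 ps /\ all phi (unzip1 ps).
Proof.
elim: ps => //= q ps IH; split=> [/andP[/andP[/eqP-> ->] /IH[-> ->]] //|[[h1 h2] /andP[h3 h4]]].
by rewrite /keep h1 eqxx h3 /=; apply/IH.
Qed.

Lemma col_updE X s r v i : col X (upd s r v) i = (if v == i then cset r else cdel r) (col X s i).
Proof.
have E : col X (upd s r v) i = (X i, if v == i then r |: [set x | s x == i] else [set x | s x == i] :\ r).
  congr (_, _); apply/setP => x; rewrite inE ffunE.
  by case: (v == i) / eqP => vi; rewrite !inE; case: (x =P r) => //= _; case: eqP vi.
by rewrite E; case: eqP.
Qed.

Lemma col_out X (s : store) r i : s r != i -> cdel r (col X s i) = col X s i.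
Proof.
move=> h; congr (_, _); apply/setP => x; rewrite !inE; case: eqP => //= ->.
by rewrite (negbTE h).
Qed.

Lemma col_upd_out X (s : store) r v i : s r != i -> v != i -> col X (upd s r v) i = col X s i.
Proof. by move=> h1 h2; rewrite col_updE (negbTE h2) col_out. Qed.

Lemma all_tape N X s phi : all phi (tape N X s) <-> forall i, i <= N -> phi (col X s i).
Proof.
split=> [/allP h i iN|h]; first by apply: h; rewrite map_f // mem_iota.
by apply/allP => c /mapP[i]; rewrite mem_iota => /andP[_ iN] ->; apply: h.
Qed.

(** Boundedness puts the mark of each register inside the tape; otherwise [Equal] and [Member] could
    pass with no column to inspect. *)
Lemma crow_sound N X c s ps : bounded N s -> lang (crow c) ps -> unzip1 ps = tape N X s ->
  exists2 s', csem N X c s s' & unzip2 ps = tape N X s'.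
Proof.
move=> bs; case: c => [r|r|r r'|b r].
- case=> u [v [-> /lang_anyp[q /eqP q2 ->] /lang_all/all_maps e2]] /= [q1 e1].
  exists (upd s r 0) => //; rewrite q2 e2 q1 e1 /tape /= col_updE /=; congr (_ :: _).
  rewrite -map_comp; apply/eq_in_map => i; rewrite mem_iota => /andP[i0 _] /=.
  by rewrite col_updE; case: i i0.
- case=> p1 [w1 [-> /lang_all/all_keep[e1 a1] [w2 [w3 [-> /lang_anyp[b /andP[rb /eqP b2] ->]]]]]].
  case=> w4 [p2 [-> /lang_anyp[c /eqP c2 ->] /lang_all/all_keep[e2 a2]]] /=.
  rewrite /unzip1 map_cat /= => eT.
  (* The two columns of the move sit between [p1] and [p2]; comparing lengths lets the equation with
     the tape be split there. *)
  have sz : N.+1 = size p1 + (size p2).+2.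
    by have := congr1 size eT; rewrite size_cat /= !size_map size_iota => <-.
  move: eT; rewrite /tape sz iotaD map_cat => /eqP.
  rewrite eqseq_cat ?size_map ?size_iota //= add0n => /andP[/eqP E1 /eqP[b1 c1 E2]].
  have sr : s r = size p1 by move: rb; rewrite b1 inE => /eqP.
  exists (upd s r (s r).+1); first by split=> //; lia.
  rewrite /unzip2 !map_cat /= -/(unzip2 p1) -/(unzip2 p2) e1 e2.
  rewrite [unzip1 p1]E1 [unzip1 p2]E2 b2 c2 b1 c1; congr (_ ++ _ :: _ :: _).
  + apply/eq_in_map => i; rewrite mem_iota => /andP[_ lt].
    by rewrite col_upd_out // sr; lia.
  + by rewrite col_updE sr; case: eqP => //; lia.
  + by rewrite col_updE sr eqxx.
  + apply/eq_in_map => i; rewrite mem_iota => /andP[lt _].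
    by rewrite col_upd_out // sr; lia.
- move=> /lang_all/all_keep[-> h] e; exists s => //; split=> //.
  move: h; rewrite e => /all_tape/(_ _ (bs r)) /=; rewrite !inE eqxx.
  by move=> /eqP/esym/eqP.
- move=> /lang_all/all_keep[-> h] e; exists s => //; split=> //.
  by move: h; rewrite e => /all_tape/(_ _ (bs r)) /=; rewrite !inE eqxx => /eqP.
Qed.

Lemma crow_complete N X c s s' : csem N X c s s' ->
  exists2 ps, lang (crow c) ps & unzip1 ps = tape N X s /\ unzip2 ps = tape N X s'.
Proof.
pose q i := (col X s i, col X s' i).
move=> h; exists (map q (iota 0 N.+1)); last first.
  by rewrite /tape /unzip1 /unzip2 -!map_comp.
have keepP (phi : pred column) (l : seq nat) : s' = s ->
    (forall i, i \in l -> phi (col X s i)) -> lang (Star (anyp (keep phi))) (map q l).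
  move=> es hp; apply/lang_all; rewrite all_map; apply/allP => i il /=.
  by rewrite /keep /= es eqxx hp.
case: c h => [r es|r [lt es]|r r' [e1 e2]|b r [e1 e2]]; rewrite /crow.
- exists [:: q 0], (map q (iota 1 N)); split=> //.
    by apply/lang_anyp; exists (q 0) => //; rewrite /maps /= es col_updE.
  apply/lang_all; rewrite all_map; apply/allP => i; rewrite mem_iota => /andP[i0 _] /=.
  by rewrite /maps /= es col_updE; case: i i0.
- have -> : N.+1 = s r + (N - s r).+1 by lia.
  have -> : N - s r = (N - s r).-1.+1 by lia.
  have out (l : seq nat) : (forall i, i \in l -> (s r != i) && ((s r).+1 != i)) ->
      lang (Star (anyp (keep (fun c => r \notin c.2)))) (map q l).
    move=> hl; apply/lang_all; rewrite all_map; apply/allP => i /hl/andP[h1 h2] /=.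
    by rewrite /keep /= es col_upd_out // eqxx inE.
  rewrite iotaD map_cat add0n; eexists _, _; split; first by [].
    by apply: out => i; rewrite mem_iota => /andP[_ h]; lia.
  exists [:: q (s r)], (map q (iota (s r).+1 (N - s r).-1.+1)); split=> //.
    apply/lang_anyp; exists (q (s r)) => //=.
    by rewrite inE eqxx /maps /= es col_updE; rewrite gtn_eqF.
  exists [:: q (s r).+1], (map q (iota (s r).+2 (N - s r).-1)); split=> //.
    by apply/lang_anyp; exists (q (s r).+1) => //=; rewrite /maps /= es col_updE eqxx.
  by apply: out => i; rewrite mem_iota => /andP[h _]; lia.
- by apply: keepP => // i _; rewrite !inE e1.
- by apply: keepP => // i _; rewrite inE /=; apply/implyP => /eqP<-; rewrite e1.
Qed.

Fixpoint cruns (N : nat) (X : nat -> bool) (cs : seq cmd) (s s' : store) : Prop :=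
  if cs is c :: cs' then exists2 t, csem N X c s t & cruns N X cs' t s' else s' = s.

Lemma cruns_runs N X cs s : bounded N s ->
  (exists s', runs crow cs (tape N X s) s') <-> exists s', cruns N X cs s s'.
Proof.
elim: cs s => [|c cs IH] s bs /=; first by split=> _; [exists s | exists (tape N X s)].
split=> [[s' [ps [Lps e1]]]|[s' [t ct /(ex_intro _ s')/IH[|s'' rs]]]].
- have [t ct ->] := crow_sound bs Lps e1.
  move/(ex_intro _ s')/(IH t (csem_bounded ct bs)) => [s'' rs].
  by exists s'', t.
- exact: csem_bounded ct bs.
- have [ps Lps [e1 e2]] := crow_complete ct.
  by exists s'', ps; rewrite e2.
Qed.

(** * Initial tapes and the guess of [X] *)

Variables (top kreg : V).
Hypothesis top_neq : top != kreg.

Definition start (N k : nat) : store :=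
  [ffun r => if r == top then N else if r == kreg then k else 0].

(** [b1] is the mark of [top], [b2] that of the registers starting at 0, and [x.1] places [kreg]
    where the target is cancelled. The bit [x.2.1] is left open: this is where [X] is guessed. *)
Definition init_col (b1 b2 : bool) : pred (bool * column) :=
  fun x => x.2.2 == [set r | if r == top then b1 else if r == kreg then x.1 else b2].
(** The first and last columns are distinct, which gives [0 < N]; [top] marks the last one and so
    holds the bound. *)
Definition init_re : re (bool * column) :=
  Cat (anyp (init_col false true)) (Cat (Star (anyp (init_col false false))) (anyp (init_col true false))).

Definition init_row (N : nat) (X : nat -> bool) (k : nat) : seq (bool * column) :=
  map (fun i => (i == k, col X (start N k) i)) (iota 0 N.+1).

Lemma start_col N k i X (b1 b2 : bool) : b1 = (N == i) -> b2 = (0 == i) ->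
  init_col b1 b2 (i == k, col X (start N k) i).
Proof.
move=> -> ->; apply/eqP/setP => r; rewrite !inE /= ffunE.
by case: (r == top) => //; case: (r == kreg) => //; rewrite eq_sym.
Qed.

Lemma init_complete N X k : 0 < N -> lang init_re (init_row N X k).
Proof.
case: N => // N _; rewrite /init_row.
have -> : iota 0 N.+2 = 0 :: iota 1 N ++ [:: N.+1] by rewrite -[N.+2]addn1 iotaD.
rewrite /= map_cat.
pose q i := (i == k, col X (start N.+1 k) i).
exists [:: q 0], (map q (iota 1 N) ++ [:: q N.+1]); split=> //.
  by apply/lang_anyp; exists (q 0) => //; apply: start_col.
exists (map q (iota 1 N)), [:: q N.+1]; split=> //; last first.
  by apply/lang_anyp; exists (q N.+1) => //; apply: start_col; rewrite ?eqxx.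
apply/lang_all; rewrite all_map; apply/allP => i; rewrite mem_iota => /andP[i0 iN].
by apply: start_col; apply/esym/eqP; lia.
Qed.

Lemma init_sound ms k : lang init_re ms -> (forall i, nth false (unzip1 ms) i = (i == k)) ->
  exists N X, [/\ 0 < N, k <= N & unzip2 ms = tape N X (start N k)].
Proof.
move=> Lms mk.
have [d _] : exists d : bool * column, True by exists (true, (true, set0)).
have [N sz N0] : exists2 N, size ms = N.+1 & 0 < N.
  case: Lms => w1 [w2 [-> /lang_anyp[a _ ->] [m [w3 [-> _ /lang_anyp[l _ ->]]]]]] /=.
  by exists (size m).+1; rewrite ?size_cat ?addn1.
have colE i : i <= N -> init_col (N == i) (0 == i) (nth d ms i).
  case: Lms sz => w1 [w2 [-> /lang_anyp[a Pa ->] [m [w3 [-> /lang_all Pm /lang_anyp[l Pl ->]]]]]] /=.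
  rewrite size_cat /= addn1 => -[eN]; rewrite -eN; case: i => [|i] //= iN.
  rewrite eqSS nth_cat; case: ltnP => im.
    by rewrite gtn_eqF //; apply: (all_nthP _ Pm).
  by have -> : i = size m; [lia | rewrite eqxx subnn].
pose X i := (nth d ms i).2.1.
exists N, X; split=> //.
  (* Past the end of the row [nth] answers [false], so the mark lies inside and [k <= N]. *)
  rewrite -ltnS -sz -(size_map fst) ltnNge; apply/negP => le.
  by have := mk k; rewrite nth_default ?eqxx.
apply: (@eq_from_nth _ d.2) => [|i]; rewrite !size_map ?size_iota // sz ltnS => iN.
rewrite (nth_map d) ?sz // (nth_map 0) ?size_iota // nth_iota // add0n.
have /eqP e := colE i iN.
rewrite [LHS]surjective_pairing e; congr (_, _); apply/setP => r; rewrite !inE ffunE.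
case: (r == top) => //; case: (r == kreg) => //.
by rewrite eq_sym -mk (nth_map d) ?sz //.
Qed.

Definition exec (N : nat) (X : nat -> bool) (e : re cmd) (s s' : store) : Prop :=
  exists2 cs, lang e cs & cruns N X cs s s'.

Theorem register_rat n (prog : re cmd) : exists A : dfa, forall k,
  rat_mem n A (target k) <->
  exists N X s', [/\ 0 < N, k <= N & exec N X prog (start N k) s'].
Proof.
have [A AE] := transducer_rat (true, set0) crow prog init_re n.
have bs N k : k <= N -> bounded N (start N k).
  by move=> kN r; rewrite ffunE; case: eqP => // _; case: eqP.
exists A => k; rewrite AE; split=> [[ms [cs [s' [Lms mk Lcs rs]]]]|[N [X [s' [N0 kN [cs Lcs rs]]]]]].
  have [N [X [N0 kN e]]] := init_sound Lms mk.
  have : exists s', runs crow cs (tape N X (start N k)) s' by exists s'; rewrite -e.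
  move/(cruns_runs _ _ (bs _ _ kN)) => [t rt].
  by exists N, X, t; split=> //; exists cs.
have : exists s', cruns N X cs (start N k) s' by exists s'.
move/(cruns_runs _ _ (bs _ _ kN)) => [t rt].
exists (init_row N X k), cs, t; split=> //.
- exact: init_complete.
- move=> i; rewrite /unzip1 -map_comp; case: (ltnP i N.+1) => iN.
    by rewrite (nth_map 0) ?size_iota // nth_iota.
  by rewrite nth_default ?size_map ?size_iota //; apply/esym/eqP; lia.
- by rewrite /unzip2 -map_comp.
Qed.

(** * Execution of regular programs *)

Lemma cruns_cat N X cs1 cs2 s s' :
  cruns N X (cs1 ++ cs2) s s' <-> exists2 t, cruns N X cs1 s t & cruns N X cs2 t s'.
Proof.
elim: cs1 s => [|c cs IH] s /=; first by split=> [h|[t ->]] //; exists s.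
split=> [[u cu /IH[t t1 t2]]|[t [u cu t1] t2]]; first by exists t => //; exists u.
by exists u => //; apply/IH; exists t.
Qed.

Lemma exec_eps N X s s' : exec N X Eps s s' <-> s' = s.
Proof. by split=> [[cs -> ]|->] //; exists [::]. Qed.

Lemma exec_sym N X c s s' : exec N X (Sym c) s s' <-> csem N X c s s'.
Proof. by split=> [[cs -> [t ct ->]]|ct] //; exists [:: c] => //; exists s'. Qed.

Lemma exec_alt N X e1 e2 s s' : exec N X (Alt e1 e2) s s' <-> exec N X e1 s s' \/ exec N X e2 s s'.
Proof.
split=> [[cs [L|L] r]|[[cs L r]|[cs L r]]].
- by left; exists cs.
- by right; exists cs.
- by exists cs => //; left.
- by exists cs => //; right.
Qed.

Lemma exec_cat N X e1 e2 s s' :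
  exec N X (Cat e1 e2) s s' <-> exists2 t, exec N X e1 s t & exec N X e2 t s'.
Proof.
split=> [[cs [u [v [-> L1 L2]]] /cruns_cat[t r1 r2]]|[t [u L1 r1] [v L2 r2]]].
  by exists t; [exists u | exists v].
by exists (u ++ v); [exists u, v | apply/cruns_cat; exists t].
Qed.

Lemma exec_star0 N X e s : exec N X (Star e) s s.
Proof. by exists [::] => //; constructor. Qed.

Lemma exec_starS N X e s t s' : exec N X e s t -> exec N X (Star e) t s' -> exec N X (Star e) s s'.
Proof.
move=> [u Lu ru] [v Lv rv]; exists (u ++ v); first exact: star_cons.
by apply/cruns_cat; exists t.
Qed.

Lemma exec_star_ind N X e (P : store -> Prop) s s' :
  (forall t t', P t -> exec N X e t t' -> P t') -> P s -> exec N X (Star e) s s' -> P s'.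
Proof.
move=> step Ps [cs L]; elim: L s Ps => [s Ps ->|u v Lu _ IH s Ps /cruns_cat[t ru /IH]] //.
by apply; apply: step Ps _; exists u.
Qed.

Lemma exec_bounded N X e s s' : exec N X e s s' -> bounded N s -> bounded N s'.
Proof.
case=> cs _; elim: cs s => [s ->|c cs IH s [t /csem_bounded ct /IH rt /ct]] //.
Qed.

End Registers.

(** * Horn rules over registers *)

(** Since (a + b)^2 + a is less than the next square, a + b and then a are recovered. Additions
    suffice to compute it, and the successor keeps 0 free for the empty list. *)
Definition pr (a b : nat) : nat := ((a + b) ^ 2 + a).+1.

Lemma pr_inj a b c d : pr a b = pr c d -> a = c /\ b = d.
Proof.
rewrite /pr => -[e]; have e1 : a + b = c + d.
  by case: (ltngtP (a + b) (c + d)) => // lt; nia.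
by split; move: e; rewrite e1; lia.
Qed.

(** Room for the longest rule, whose last variable is ['v 21]. *)
Definition nvars := 24.
Definition reg : finType := ('I_4 + 'I_nvars)%type.
Notation vr v := (@inr 'I_4 'I_nvars v).
Notation "''v' i" := (@Ordinal nvars i isT) (at level 8, i at level 2).

Inductive atom :=
  | AConst (a : 'I_nvars) (c : nat)
  | ASucc (a b : 'I_nvars)
  | APair (a b c : 'I_nvars)
  | AMem (a : 'I_nvars).

Definition holds (X : nat -> bool) (f : 'I_nvars -> nat) (x : atom) : Prop :=
  match x with
  | AConst a c => f a = c
  | ASucc a b => f a = (f b).+1
  | APair a b c => f c = pr (f a) (f b)
  | AMem a => X (f a)
  end.

Definition holds_all (X : nat -> bool) (f : 'I_nvars -> nat) (r : seq atom) : Prop :=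
  foldr (fun x P => holds X f x /\ P) True r.

Lemma holds_all_ext X f g r : f =1 g -> holds_all X f r <-> holds_all X g r.
Proof.
move=> e; elim: r => //= x r ->.
by case: x => [a c|a b|a b c|a] /=; rewrite !e.
Qed.

Section Programs.
Variables (N : nat) (X : nat -> bool).

Definition rs : reg := inl (@Ordinal 4 0 isT).
Definition ru : reg := inl (@Ordinal 4 1 isT).
Definition ri : reg := inl (@Ordinal 4 2 isT).
Definition rj : reg := inl (@Ordinal 4 3 isT).

Definition same (t t' : store reg) : Prop := forall v, t' (vr v) = t (vr v).

Definition seqs (T : Type) (es : seq (re T)) : re T := foldr (@Cat T) Eps es.
Arguments seqs : simpl never.

(** The number of rounds is guessed, [rj] counts them, and [Equal rj a] rejects wrong guesses. *)
Definition add_to (u a : reg) : re (cmd reg) :=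
  seqs [:: Sym (Zero rj); Star (seqs [:: Sym (Inc rj); Sym (Inc u)]); Sym (Equal rj a)].

Notation run e := (@exec reg N X e).

Lemma run_cons e es s s' : run (seqs (e :: es)) s s' <-> exists2 t, run e s t & run (seqs es) t s'.
Proof. exact: exec_cat. Qed.

Lemma run_nil s s' : run (seqs [::]) s s' <-> s' = s.
Proof. exact: exec_eps. Qed.

Lemma run_inc r s s' : run (Sym (Inc r)) s s' -> s' = upd s r (s r).+1.
Proof. by case/exec_sym. Qed.

Lemma add_toP u a t t' : u != rj -> a != rj -> a != u -> run (add_to u a) t t' ->
  t' u = t u + t a /\ forall x, x != u -> x != rj -> t' x = t x.
Proof.
rewrite /add_to => uj aj au /run_cons[t1 /exec_sym ->] /run_cons[t2 st] /run_cons[t3 /exec_sym[eq ->] /run_nil->].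
pose P (s : store reg) := s u = t u + s rj /\ forall x, x != u -> x != rj -> s x = t x.
have [h1 h2] : P t2.
  apply: (exec_star_ind (P := P)) st; last first.
    by split=> [|x xu xj]; rewrite !ffunE ?eqxx ?(negbTE uj) ?addn0 ?(negbTE xj).
  move=> s s' [h1 h2] /run_cons[s1 /run_inc-> /run_cons[s2 /run_inc-> /run_nil->]].
  split=> [|x xu xj]; last by rewrite !ffunE (negbTE xu) (negbTE xj) h2.
  by rewrite !ffunE !eqxx (negbTE uj) eq_sym (negbTE uj) h1 addnS.
by split=> //; rewrite h1 eq h2.
Qed.

Lemma add_to_ex u a (t : store reg) : u != rj -> a != rj -> a != u -> t u + t a <= N ->
  exists t', run (add_to u a) t t'.
Proof.
move=> uj aj au le.
have st d (s : store reg) : s rj + d <= N -> s u + d <= N ->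
    exists2 s', run (Star (seqs [:: Sym (Inc rj); Sym (Inc u)])) s s' &
      s' rj = s rj + d /\ forall x, x != u -> x != rj -> s' x = s x.
  elim: d s => [|d IH] s l1 l2; first by exists s; rewrite ?addn0 //; apply: exec_star0.
  pose s1 := upd s rj (s rj).+1; pose s2 := upd s1 u (s1 u).+1.
  have e1 : s2 rj = (s rj).+1 by rewrite !ffunE eqxx eq_sym (negbTE uj).
  have e2 : s2 u = (s u).+1 by rewrite !ffunE eqxx (negbTE uj).
  have [||s' st [h1 h2]] := IH s2; rewrite ?e1 ?e2 ?addSnnS //.
  exists s'; last first.
    split; first by rewrite h1 e1 addSnnS.
    by move=> x xu xj; rewrite h2 // !ffunE (negbTE xu) (negbTE xj).
  apply: exec_starS st; apply/run_cons; exists s1; first by apply/exec_sym; split=> //; lia.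
  apply/run_cons; exists s2; last exact/run_nil.
  by apply/exec_sym; split=> //; rewrite ffunE (negbTE uj); lia.
pose t1 := upd t rj 0.
have e1 : t1 rj = 0 by rewrite ffunE eqxx.
have e2 : t1 u = t u by rewrite ffunE (negbTE uj).
have [||t2 r2 [h1 h2]] := st (t a) t1; rewrite ?e1 ?e2 //; first by lia.
rewrite /add_to; exists t2; apply/run_cons; exists t1; first exact/exec_sym.
apply/run_cons; exists t2 => //; apply/run_cons; exists t2; last exact/run_nil.
by apply/exec_sym; split=> //; rewrite h1 e1 h2 // ffunE (negbTE aj).
Qed.

(** Values are built upwards in scratch registers and compared at the end, so the variables survive.
    For [APair] the square is a repeated addition: each round adds [rs] to [ru], until [ri] has
    counted [rs] rounds. *)
Definition test (x : atom) : re (cmd reg) :=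
  match x with
  | AConst a c => seqs (Sym (Zero ru) :: nseq c (Sym (Inc ru)) ++ [:: Sym (Equal ru (vr a))])
  | ASucc a b => seqs [:: Sym (Zero ru); add_to ru (vr b); Sym (Inc ru); Sym (Equal ru (vr a))]
  | APair a b c => seqs [:: Sym (Zero rs); add_to rs (vr a); add_to rs (vr b);
      Sym (Zero ru); Sym (Zero ri); Star (seqs [:: Sym (Inc ri); add_to ru rs]); Sym (Equal ri rs);
      add_to ru (vr a); Sym (Inc ru); Sym (Equal ru (vr c))]
  | AMem a => Sym (Member true (vr a))
  end.

Lemma test_sound x s s' : run (test x) s s' -> holds X (fun v => s (vr v)) x /\ same s s'.
Proof.
case: x => [a c|a b|a b c|a] /=.
- case/run_cons=> t /exec_sym -> /=.
  have -> : s (vr a) = c <-> s (vr a) = upd s ru 0 ru + c by rewrite ffunE eqxx add0n.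
  have : same s (upd s ru 0) by move=> v; rewrite ffunE.
  elim: c (upd s ru 0) => [|c IH] t1 st /= /run_cons[t2].
    move=> /exec_sym[e ->] /run_nil ->; split=> //.
    by rewrite addn0 e st.
  move=> /run_inc-> /IH[v|]; rewrite ?ffunE ?st // => e; split=> //.
  by rewrite e ?ffunE ?eqxx addSnnS.
- case/run_cons=> t1 /exec_sym -> /run_cons[t2 /add_toP[//|//|//|e1 e2]].
  case/run_cons=> t3 /run_inc-> /run_cons[t4 /exec_sym[e3 ->] /run_nil->].
  split=> [|v]; last by rewrite ffunE /= e2 // ffunE.
  by move: e3; rewrite !ffunE /= e1 e2 // !ffunE /= => <-.
- case/run_cons=> t1 /exec_sym -> /run_cons[t2 /add_toP[//|//|//|a1 a2]].
  case/run_cons=> t3 /add_toP[//|//|//|b1 b2].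
  case/run_cons=> t4 /exec_sym -> /run_cons[t5 /exec_sym ->] /run_cons[t6 st].
  case/run_cons=> t7 /exec_sym[es ->] /run_cons[t8 /add_toP[//|//|//|c1 c2]].
  case/run_cons=> t9 /run_inc-> /run_cons[t10 /exec_sym[e3 ->] /run_nil->].
  have h3 : t3 rs = s (vr a) + s (vr b) by rewrite b1 a1 a2 // !ffunE.
  have v3 v : t3 (vr v) = s (vr v) by rewrite b2 // a2 // ffunE.
  pose P (t : store reg) := [/\ t rs = s (vr a) + s (vr b), t ru = t ri * t rs &
                              forall v, t (vr v) = s (vr v)].
  have [p1 p2 p3] : P t6.
    apply: (exec_star_ind (P := P)) st; last first.
      by split=> [||v]; rewrite !ffunE /= ?h3 ?v3.
    move=> t t' [q1 q2 q3] /run_cons[u1 /run_inc-> /run_cons[u2 /add_toP[//|//|//|d1 d2] /run_nil->]].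
    split=> [||v].
    + by rewrite d2 // ffunE /= q1.
    + by rewrite d1 !d2 // !ffunE /= q2 mulSn addnC.
    + by rewrite d2 // ffunE /= q3.
  split=> [|v]; last by rewrite ffunE /= c2 // p3.
  move: e3; rewrite !ffunE /= c1 c2 // !p3 p2 es p1 => <-.
  by rewrite /pr mulnn.
- by case/exec_sym=> h ->.
Qed.

(** Intermediate values never exceed the value compared at the end, which a variable holds and [N]
    bounds; so the bound does not block a correct run. *)
Lemma test_complete x (s : store reg) : (forall v, s (vr v) <= N) -> holds X (fun v => s (vr v)) x ->
  exists2 s', run (test x) s s' & same s s'.
Proof.
move=> bs; suff ex : holds X (fun v => s (vr v)) x -> exists s', run (test x) s s'.
  by move/ex=> [s' r]; exists s' => //; case: (test_sound r).
case: x => [a c|a b|a b c|a] /= h.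
- suff : forall t : store reg, t ru + c = s (vr a) -> t (vr a) = s (vr a) ->
      exists s', run (seqs (nseq c (Sym (Inc ru)) ++ [:: Sym (Equal ru (vr a))])) t s'.
    case/(_ (upd s ru 0)); rewrite ?ffunE ?eqxx // => s' r.
    by exists s'; apply/run_cons; exists (upd s ru 0); first exact/exec_sym.
  move: (bs a) => ba {h}; elim: c => [|c IH] t e1 e2.
    exists t; apply/run_cons; exists t; last exact/run_nil.
    by apply/exec_sym; split=> //; rewrite e2 -e1 addn0.
  have [||s' r] := IH (upd t ru (t ru).+1); rewrite ?ffunE ?eqxx //; first by rewrite addSnnS.
  exists s'; apply/run_cons; exists (upd t ru (t ru).+1) => //.
  by apply/exec_sym; split=> //; lia.
- have := bs a; rewrite h => lt.
  have [//|//|//||t r] := @add_to_ex ru (vr b) (upd s ru 0); first by rewrite !ffunE /=; lia.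
  have [//|//|//|e1 e2] := add_toP _ _ _ r.
  have e : t ru = s (vr b) by rewrite e1 !ffunE.
  exists (upd t ru (t ru).+1); apply/run_cons; exists (upd s ru 0); first exact/exec_sym.
  apply/run_cons; exists t => //; apply/run_cons; exists (upd t ru (t ru).+1).
    by apply/exec_sym; split=> //; rewrite e.
  apply/run_cons; exists (upd t ru (t ru).+1); last exact/run_nil.
  by apply/exec_sym; split=> //; rewrite !ffunE /= e e2 // ffunE h.
- have [S ES] : {S | s (vr a) + s (vr b) = S} by eexists.
  have := bs c; rewrite h /pr ES => le.
  (* The bound for the sum comes from [S <= S ^ 2], the square being below the code. *)
  have leS : S <= N by have := leq_pmull S (ltn0Sn S); nia.
  have [//|//|//||t2 r2] := @add_to_ex rs (vr a) (upd s rs 0); first by rewrite !ffunE /= add0n bs.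
  have [//|//|//|a1 a2] := add_toP _ _ _ r2.
  have [//|//|//||t3 r3] := @add_to_ex rs (vr b) t2; first by rewrite a1 a2 // !ffunE /= add0n ES.
  have [//|//|//|b1 b2] := add_toP _ _ _ r3.
  have h3 : t3 rs = S by rewrite b1 a1 a2 // !ffunE /= add0n ES.
  have v3 v : t3 (vr v) = s (vr v) by rewrite b2 // a2 // ffunE.
  have st d (t : store reg) : t rs = S -> t ri + d = S -> t ru + d * S <= N ->
      exists2 t', run (Star (seqs [:: Sym (Inc ri); add_to ru rs])) t t' &
      [/\ t' ri = S, t' rs = S, t' ru = t ru + d * S & same t t'].
    elim: d t => [|d IH] t e1 e2 e3.
      by exists t; [apply: exec_star0 | split=> //; lia].
    rewrite mulSn in e3 *.
    have [//|//|//||t' r] := @add_to_ex ru rs (upd t ri (t ri).+1).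
      by rewrite !ffunE /= e1; apply: leq_trans e3; rewrite leq_add2l leq_addr.
    have [//|//|//|d1 d2] := add_toP _ _ _ r.
    have [|||t'' r' [f1 f2 f3 f4]] := IH t'.
    + by rewrite d2 // ffunE.
    + by rewrite d2 // ffunE eqxx addSnnS.
    + by rewrite d1 !ffunE /= e1 -addnA.
    exists t''.
      apply: exec_starS r'; apply/run_cons; exists (upd t ri (t ri).+1).
        by apply/exec_sym; split=> //; lia.
      by apply/run_cons; exists t' => //; apply/run_nil.
    split=> // [|v]; last by rewrite f4 d2 // ffunE.
    by rewrite f3 d1 !ffunE /= e1 addnA.
  pose t5 := upd (upd t3 ru 0) ri 0.
  have q1 : t5 rs = S by rewrite !ffunE /= h3.
  have q2 : t5 ri + S = S by rewrite ffunE eqxx.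
  have q3 : t5 ru = 0 by rewrite !ffunE.
  have [|t6 r6 [f1 f2 f3 f4]] := st S t5 q1 q2; first by rewrite q3 add0n mulnn; lia.
  have f5 : t6 ru = S * S by rewrite f3 q3.
  have f6 v : t6 (vr v) = s (vr v) by rewrite f4 !ffunE v3.
  have [//|//|//||t8 r8] := @add_to_ex ru (vr a) t6; first by rewrite f5 f6 mulnn; apply: ltnW.
  have [//|//|//|c1 c2] := add_toP _ _ _ r8.
  have g1 : t8 ru = S ^ 2 + s (vr a) by rewrite c1 f5 f6 mulnn.
  exists (upd t8 ru (t8 ru).+1).
  apply/run_cons; exists (upd s rs 0); first exact/exec_sym.
  apply/run_cons; exists t2 => //; apply/run_cons; exists t3 => //.
  apply/run_cons; exists (upd t3 ru 0); first exact/exec_sym.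
  apply/run_cons; exists t5; first exact/exec_sym.
  apply/run_cons; exists t6 => //; apply/run_cons; exists t6; first by apply/exec_sym; split=> //; rewrite f1 f2.
  apply/run_cons; exists t8 => //; apply/run_cons; exists (upd t8 ru (t8 ru).+1).
    by apply/exec_sym; split=> //; rewrite g1.
  apply/run_cons; exists (upd t8 ru (t8 ru).+1); last exact/run_nil.
  by apply/exec_sym; split=> //; rewrite !ffunE /= g1 c2 // f6 h /pr ES.
- by exists s; apply/exec_sym.
Qed.

Lemma tests_sound r s s' : run (seqs (map test r)) s s' ->
  holds_all X (fun v => s (vr v)) r /\ same s s'.
Proof.
elim: r s => [|x r IH] s /=; first by move/run_nil=> ->.
case/run_cons=> t /test_sound[hx st] /IH[hr st']; split=> [|v]; last by rewrite st' st.
by split=> //; apply/(holds_all_ext X r st).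
Qed.

Lemma tests_complete r (s : store reg) : (forall v, s (vr v) <= N) ->
  holds_all X (fun v => s (vr v)) r -> exists2 s', run (seqs (map test r)) s s' & same s s'.
Proof.
elim: r s => [|x r IH] s bs /=; first by move=> _; exists s => //; apply/run_nil.
case=> /(test_complete bs)[t rt st] hr.
have [v||s' rs' st'] := IH t; first by rewrite st.
  by apply/(holds_all_ext X r (fun v => esym (st v))).
by exists s' => [|v]; [apply/run_cons; exists t | rewrite st' st].
Qed.

(** * Guessing values for the variables of a rule *)

Definition havoc (v : 'I_nvars) : re (cmd reg) :=
  seqs [:: Sym (Zero (vr v)); Star (Sym (Inc (vr v)))].

Lemma havoc_sound v s s' : run (havoc v) s s' -> forall x, x != vr v -> s' x = s x.
Proof.
rewrite /havoc => /run_cons[t /exec_sym -> /run_cons[t' st /run_nil->]] x xv.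
apply: (exec_star_ind (P := fun t : store reg => t x = s x)) st.
  by move=> t1 t2 e /run_inc->; rewrite ffunE (negbTE xv).
by rewrite ffunE (negbTE xv).
Qed.

Lemma havoc_complete v c s : c <= N -> run (havoc v) s (upd s (vr v) c).
Proof.
move=> cN; rewrite /havoc; apply/run_cons; exists (upd s (vr v) 0); first exact/exec_sym.
apply/run_cons; exists (upd s (vr v) c); last exact/run_nil.
have st d i : i + d <= N -> run (Star (Sym (Inc (vr v)))) (upd s (vr v) i) (upd s (vr v) (i + d)).
  elim: d i => [|d IH] i le; first by rewrite addn0; apply: exec_star0.
  rewrite -addSnnS; apply: (@exec_starS _ _ _ _ _ (upd s (vr v) i.+1)); last by apply: IH; rewrite addSnnS.
  apply/exec_sym; split; first by rewrite ffunE eqxx; lia.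
  by apply/ffunP => x; rewrite !ffunE eqxx; case: eqP.
exact: (st c 0).
Qed.

Lemma havocs_sound l s s' : run (seqs (map havoc l)) s s' -> forall v, v \notin l -> s' (vr v) = s (vr v).
Proof.
elim: l s => [|w l IH] s /=; first by move/run_nil=> ->.
case/run_cons=> t /havoc_sound h /IH{}IH v; rewrite inE negb_or => /andP[vw vl].
by rewrite IH // h.
Qed.

Lemma havocs_complete l f (s : store reg) : (forall v, f v <= N) ->
  exists2 s', run (seqs (map havoc l)) s s' &
    forall v, s' (vr v) = if v \in l then f v else s (vr v).
Proof.
move=> fN; elim: l s => [|w l IH] s /=; first by exists s => //; apply/run_nil.
have [s' r h] := IH (upd s (vr w) (f w)); exists s' => [|v].
  by apply/run_cons; exists (upd s (vr w) (f w)) => //; apply: havoc_complete.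
rewrite h ffunE inE -[vr v == vr w]/(v == w); case: (v \in l); rewrite ?orbT ?orbF //.
by case: eqP => [->|].
Qed.

Definition free : seq 'I_nvars := [seq v : 'I_nvars <- enum 'I_nvars | 2 < v].

Definition solve (r : seq atom) : re (cmd reg) := seqs (map havoc free ++ map test r).

(* Registers 0, 1 and 2 hold the number under scrutiny, the input and the bound [N]; the other
   ones are guessed. *)
Definition rule_at (p k : nat) (r : seq atom) : Prop :=
  exists f, [/\ forall v, f v <= N, f ('v 0) = p, f ('v 1) = k, f ('v 2) = N & holds_all X f r].

Lemma run_seqs_cat es1 es2 s s' :
  run (seqs (es1 ++ es2)) s s' <-> exists2 t, run (seqs es1) s t & run (seqs es2) t s'.
Proof.
elim: es1 s => [|e es1 IH] s /=.
  by split=> [r|[t /run_nil-> //]]; exists s => //; apply/run_nil.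
split=> [/run_cons[t rt /IH[u ru ru']]|[t /run_cons[u ru rt] rt']].
  by exists u => //; apply/run_cons; exists t.
by apply/run_cons; exists u => //; apply/IH; exists t.
Qed.

Definition frame (s s' : store reg) : Prop := forall v : 'I_nvars, v <= 2 -> s' (vr v) = s (vr v).

Lemma solve_sound r s s' : bounded N s -> s (vr ('v 2)) = N -> run (solve r) s s' ->
  rule_at (s (vr ('v 0))) (s (vr ('v 1))) r /\ frame s s'.
Proof.
move=> bs sN /run_seqs_cat[t rt /tests_sound[h st]].
have fr (v : 'I_nvars) : v <= 2 -> t (vr v) = s (vr v).
  by move=> v2; apply: (havocs_sound rt); rewrite mem_filter ltnNge v2.
split=> [|v v2]; last by rewrite st fr.
exists (fun v => t (vr v)); rewrite !fr //; split=> // v; exact: exec_bounded rt bs _.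
Qed.

Lemma solve_complete r (s : store reg) : s (vr ('v 2)) = N ->
  rule_at (s (vr ('v 0))) (s (vr ('v 1))) r -> exists2 s', run (solve r) s s' & frame s s'.
Proof.
move=> sN [f [fN f0 f1 f2 h]].
have [t rt ht] := havocs_complete free s fN.
have tf v : t (vr v) = f v.
  rewrite ht mem_filter mem_enum andbT; case: ltnP => // v2.
  case: v v2 => -[|[|[|//]]] i _.
  - by rewrite (_ : Ordinal i = 'v 0) ?f0 //; apply: val_inj.
  - by rewrite (_ : Ordinal i = 'v 1) ?f1 //; apply: val_inj.
  - by rewrite (_ : Ordinal i = 'v 2) ?f2 ?sN //; apply: val_inj.
have [v||s' r' st] := @tests_complete r t.
- by rewrite tf.
- exact/(holds_all_ext X r tf).
exists s' => [|v v2]; first by apply/run_seqs_cat; exists t.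
by rewrite st ht mem_filter ltnNge v2.
Qed.

(** * The checking loop *)

Variables (goal : seq atom) (rules : seq (seq atom)).

Definition some_rule (p k : nat) : Prop := foldr (fun r P => rule_at p k r \/ P) False rules.

Definition check : re (cmd reg) :=
  Alt (Sym (Member false (vr ('v 0)))) (foldr (fun r => Alt (solve r)) Emp rules).

Lemma check_sound s s' : bounded N s -> s (vr ('v 2)) = N -> run check s s' ->
  (X (s (vr ('v 0))) -> some_rule (s (vr ('v 0))) (s (vr ('v 1)))) /\ frame s s'.
Proof.
rewrite /check /some_rule => bs sN /exec_alt[/exec_sym[-> ->] //|].
elim: rules => [[]|r rs' IH] //= /exec_alt[/(solve_sound bs sN)[h fr]|/IH[h fr]]; split; auto.
Qed.

Lemma check_complete (s : store reg) : s (vr ('v 2)) = N ->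
  (X (s (vr ('v 0))) -> some_rule (s (vr ('v 0))) (s (vr ('v 1)))) ->
  exists2 s', run check s s' & frame s s'.
Proof.
rewrite /check /some_rule => sN hX; case h : (X (s (vr ('v 0)))); last first.
  by exists s => //; apply/exec_alt; left; apply/exec_sym.
suff ex : foldr (fun r P => rule_at (s (vr ('v 0))) (s (vr ('v 1))) r \/ P) False rules ->
    exists2 s', run (foldr (fun r => Alt (solve r)) Emp rules) s s' & frame s s'.
  by case: (ex (hX h)) => s' rs' fr; exists s' => //; apply/exec_alt; right.
elim: rules => [|r rs' IH] //= [/(solve_complete sN)|/IH] [s' r' fr]; exists s' => //; apply/exec_alt; auto.
Qed.

Definition main : re (cmd reg) :=
  seqs [:: solve goal; check; Star (seqs [:: Sym (Inc (vr ('v 0))); check]); Sym (Equal (vr ('v 0)) (vr ('v 2)))].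

(** The loop may stop anywhere, but the closing [Equal] forces the scanned number to have reached
    [N], hence to have passed through every [p <= N]. *)
Lemma main_sound (s : store reg) s' : bounded N s -> s (vr ('v 0)) = 0 -> s (vr ('v 2)) = N -> run main s s' ->
  rule_at 0 (s (vr ('v 1))) goal /\ forall p, p <= N -> X p -> some_rule p (s (vr ('v 1))).
Proof.
move=> bs s0 s2; rewrite /main => /run_cons[t1 r1 /run_cons[t2 r2 /run_cons[t3 r3 /run_cons[t4]]]].
case/exec_sym=> e _ _.
have [h fr] := solve_sound bs s2 r1; rewrite s0 in h; split=> //.
have b1 := exec_bounded r1 bs.
have [h2 fr2] := check_sound b1 (etrans (fr ('v 2) isT) s2) r2.
have b2 := exec_bounded r2 b1.
pose P (t : store reg) := [/\ bounded N t, t (vr ('v 2)) = N, t (vr ('v 1)) = s (vr ('v 1)) &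
  forall p, p <= t (vr ('v 0)) -> X p -> some_rule p (s (vr ('v 1)))].
have [_ q2 _ q4] : P t3.
  apply: (exec_star_ind (P := P)) r3; last first.
    split=> //; try by rewrite fr2 // fr.
    move=> p; rewrite fr2 // fr // s0 leqn0 => /eqP->.
    by move: h2; rewrite !fr // s0.
  move=> t t' [bt p2 p1 p0] /run_cons[u1 ru /run_cons[u2 ru' /run_nil->]].
  have bu := exec_bounded ru bt; have bu' := exec_bounded ru' bu.
  move/run_inc: ru => eu; rewrite eu in ru' bu.
  have [|g fru] := check_sound bu _ ru'; first by rewrite ffunE /= p2.
  split=> //; try by rewrite fru // ffunE /= ?p1 ?p2.
  move=> p; rewrite fru // ffunE eqxx leq_eqVlt ltnS => /orP[/eqP->|]; last exact: p0.
  by move: g; rewrite !ffunE eqxx /= p1.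
by move=> p; rewrite -q2 -e; apply: q4.
Qed.

Lemma main_complete (s : store reg) : s (vr ('v 0)) = 0 -> s (vr ('v 2)) = N ->
  rule_at 0 (s (vr ('v 1))) goal -> (forall p, p <= N -> X p -> some_rule p (s (vr ('v 1)))) ->
  exists s', run main s s'.
Proof.
move=> s0 s2 hg hr.
have [|t1 r1 f1] := @solve_complete goal s s2; first by rewrite s0.
have [||t2 r2 f2] := @check_complete t1; first by rewrite f1.
  by rewrite !f1 // s0; apply: hr.
have st d (t : store reg) : t (vr ('v 0)) + d = N -> t (vr ('v 1)) = s (vr ('v 1)) -> t (vr ('v 2)) = N ->
    exists2 t', run (Star (seqs [:: Sym (Inc (vr ('v 0))); check])) t t' &
      t' (vr ('v 0)) = t' (vr ('v 2)).
  elim: d t => [|d IH] t e0 e1 e2.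
    by exists t; [apply: exec_star0 | rewrite e2 -e0 addn0].
  pose u := upd t (vr ('v 0)) (t (vr ('v 0))).+1.
  have u0 : u (vr ('v 0)) = (t (vr ('v 0))).+1 by rewrite ffunE eqxx.
  have u1 : u (vr ('v 1)) = s (vr ('v 1)) by rewrite ffunE /= e1.
  have u2 : u (vr ('v 2)) = N by rewrite ffunE /= e2.
  have lt : t (vr ('v 0)) < N by rewrite -e0 addnS ltnS leq_addr.
  have [|v rv fv] := @check_complete u u2; first by rewrite u0 u1; apply: hr.
  have [|||t' rt' e'] := IH v; rewrite ?fv // ?u0 ?addSnnS //.
  exists t' => //; apply: exec_starS rt'; apply/run_cons; exists u; first by apply/exec_sym.
  by apply/run_cons; exists v => //; apply/run_nil.
have [|||t3 r3 e3] := st N t2; rewrite ?f2 // ?f1 // ?s0 //.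
exists t3; rewrite /main; apply/run_cons; exists t1 => //; apply/run_cons; exists t2 => //.
apply/run_cons; exists t3 => //; apply/run_cons; exists t3; last exact/run_nil.
exact/exec_sym.
Qed.

End Programs.

Theorem horn_rat n (goal : seq atom) (rules : seq (seq atom)) : exists A : dfa, forall k,
  rat_mem n A (target k) <->
  exists N X, [/\ 0 < N, k <= N, rule_at N X 0 k goal &
    forall p, p <= N -> X p -> some_rule N X rules p k].
Proof.
have [A AE] := @register_rat reg (vr ('v 2)) (vr ('v 1)) isT n (main goal rules).
exists A => k; rewrite AE.
pose s N : store reg := start (vr ('v 2)) (vr ('v 1)) N k.
have s0 N : s N (vr ('v 0)) = 0 by rewrite ffunE.
have s1 N : s N (vr ('v 1)) = k by rewrite ffunE.
have s2 N : s N (vr ('v 2)) = N by rewrite ffunE.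
split=> [[N [X [s' [N0 kN r]]]]|[N [X [N0 kN hg hr]]]].
  have bs : bounded N (s N) by move=> v; rewrite ffunE; case: (v == _) => //; case: (v == _).
  by have := main_sound bs (s0 N) (s2 N) r; rewrite s1 => -[hg hr]; exists N, X.
have [||s' r] := @main_complete N X goal rules (s N) (s0 N) (s2 N); rewrite ?s1 //.
by exists N, X, s'.
Qed.

(** * Evaluation of recursive functions *)

(* Lists of functions are coded by the tags 0 (empty) and 5, the search done by [RMu] by the tag 7. *)
Fixpoint rcode (f : recf) : nat :=
  match f with
  | RZero => pr 0 0
  | RSucc => pr 1 0
  | RProj i => pr 2 i
  | RComp f gs => pr 3 (pr (rcode f) (foldr (fun g c => pr 5 (pr (rcode g) c)) (pr 0 0) gs))
  | RPrim f g => pr 4 (pr (rcode f) (rcode g))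
  | RMu f => pr 6 (rcode f)
  end.
Definition rcodes (gs : seq recf) : nat := foldr (fun g c => pr 5 (pr (rcode g) c)) (pr 0 0) gs.
Definition lcode (v : seq nat) : nat := foldr pr 0 v.
Definition fact (e v y : nat) : nat := pr e (pr v y).

(** The clauses of [reval] read backwards for the code [pr t a]. Tag 2 walks down the list, whose
    exhausted code 0 gives the default of [nth]; tag 4 calls itself as [pr 4 a]; tag 7 keeps its
    counter at the head of the argument and moves on when the value is a successor. *)
Definition derives (X : nat -> bool) (t a v y : nat) : Prop :=
  match t with
  | 0 => y = 0
  | 1 => exists x, X (fact (pr 2 0) v x) /\ y = x.+1
  | 2 => [\/ v = 0 /\ y = 0, a = 0 /\ (exists v', v = pr y v') |
          exists j x v', [/\ a = j.+1, v = pr x v' & X (fact (pr 2 j) v' y)]]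
  | 3 => exists f gs ys, [/\ a = pr f gs, X (fact gs v ys) & X (fact f ys y)]
  | 4 => exists f g, a = pr f g /\
         ((exists v', v = pr 0 v' /\ X (fact f v' y)) \/
          exists x v' z, [/\ v = pr x.+1 v', X (fact (pr 4 a) (pr x v') z) &
                             X (fact g (pr x (pr z v')) y)])
  | 5 => exists g gs y1 ys, [/\ a = pr g gs, y = pr y1 ys, X (fact g v y1) & X (fact gs v ys)]
  | 6 => X (fact (pr 7 a) (pr 0 v) y)
  | 7 => exists x v', v = pr x v' /\
         ((X (fact a v 0) /\ y = x) \/
          exists z, X (fact a v z.+1) /\ X (fact (pr 7 a) (pr x.+1 v') y))
  | _ => False
  end.

Definition justified (X : nat -> bool) (p : nat) : Prop :=
  exists t a v y, p = fact (pr t a) v y /\ derives X t a v y.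

(** [b] and [c] receive the two nested codes, since an atom pairs only once. *)
Definition mem_fact (e v y b c : 'I_nvars) : seq atom := [:: APair v y b; APair e b c; AMem c].
(** Common layout of the rules: ['v 3] is the code [pr t a], ['v 4] the argument, ['v 5] the value,
    ['v 6] their pair, ['v 7] the tag and ['v 8] the number [a]. *)
Definition head_fact (t : nat) : seq atom :=
  [:: APair ('v 4) ('v 5) ('v 6); APair ('v 3) ('v 6) ('v 0); APair ('v 7) ('v 8) ('v 3); AConst ('v 7) t].

(** One rule per disjunct of [derives], in the same order. *)
Definition rules : seq (seq atom) :=
  [:: head_fact 0 ++ [:: AConst ('v 5) 0];
      head_fact 1 ++ [:: AConst ('v 9) 2; AConst ('v 10) 0; APair ('v 9) ('v 10) ('v 11)] ++
        mem_fact ('v 11) ('v 4) ('v 12) ('v 13) ('v 14) ++ [:: ASucc ('v 5) ('v 12)];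
      head_fact 2 ++ [:: AConst ('v 4) 0; AConst ('v 5) 0];
      head_fact 2 ++ [:: AConst ('v 8) 0; APair ('v 5) ('v 9) ('v 4)];
      head_fact 2 ++ [:: ASucc ('v 8) ('v 9); APair ('v 10) ('v 11) ('v 4); APair ('v 7) ('v 9) ('v 12)] ++
        mem_fact ('v 12) ('v 11) ('v 5) ('v 13) ('v 14);
      head_fact 3 ++ APair ('v 9) ('v 10) ('v 8) ::
        mem_fact ('v 10) ('v 4) ('v 11) ('v 12) ('v 13) ++ mem_fact ('v 9) ('v 11) ('v 5) ('v 14) ('v 15);
      head_fact 4 ++ [:: APair ('v 9) ('v 10) ('v 8); AConst ('v 11) 0; APair ('v 11) ('v 12) ('v 4)] ++
        mem_fact ('v 9) ('v 12) ('v 5) ('v 13) ('v 14);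
      head_fact 4 ++ [:: APair ('v 9) ('v 10) ('v 8); APair ('v 11) ('v 12) ('v 4); ASucc ('v 11) ('v 13);
        APair ('v 13) ('v 12) ('v 14)] ++ mem_fact ('v 3) ('v 14) ('v 15) ('v 16) ('v 17) ++
        [:: APair ('v 15) ('v 12) ('v 18); APair ('v 13) ('v 18) ('v 19)] ++
        mem_fact ('v 10) ('v 19) ('v 5) ('v 20) ('v 21);
      head_fact 5 ++ [:: APair ('v 9) ('v 10) ('v 8); APair ('v 11) ('v 12) ('v 5)] ++
        mem_fact ('v 9) ('v 4) ('v 11) ('v 13) ('v 14) ++ mem_fact ('v 10) ('v 4) ('v 12) ('v 15) ('v 16);
      head_fact 6 ++ [:: AConst ('v 9) 7; APair ('v 9) ('v 8) ('v 10); AConst ('v 11) 0;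
        APair ('v 11) ('v 4) ('v 12)] ++ mem_fact ('v 10) ('v 12) ('v 5) ('v 13) ('v 14);
      head_fact 7 ++ [:: APair ('v 5) ('v 10) ('v 4); AConst ('v 9) 0] ++
        mem_fact ('v 8) ('v 4) ('v 9) ('v 11) ('v 12);
      head_fact 7 ++ [:: APair ('v 9) ('v 10) ('v 4); ASucc ('v 11) ('v 12)] ++
        mem_fact ('v 8) ('v 4) ('v 11) ('v 13) ('v 14) ++ [:: ASucc ('v 15) ('v 9); APair ('v 15) ('v 10) ('v 16)] ++
        mem_fact ('v 3) ('v 16) ('v 5) ('v 17) ('v 18)].

(** ['v 3] serves twice: as the empty list inside the code [pr k 0] of [[:: k]], and as the value
    0. *)
Definition goal : seq atom :=
  [:: AConst ('v 3) 0; APair ('v 1) ('v 3) ('v 4)] ++ mem_fact ('v 1) ('v 4) ('v 3) ('v 5) ('v 6).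

(** Variables are at most [N], so a rule consults only this part of [X]. *)
Definition restrict (N : nat) (X : nat -> bool) (p : nat) : bool := X p && (p <= N).

Lemma holds_restrict N X f r : (forall v, f v <= N) -> holds_all X f r -> holds_all (restrict N X) f r.
Proof.
move=> fN; elim: r => //= x r IH [hx /IH hr]; split=> //.
by case: x hx => //= a Xa; rewrite /restrict Xa fN.
Qed.

Lemma some_rule_sound N X p k : some_rule N X rules p k -> justified (restrict N X) p.
Proof.
have head t f (r : seq atom) : (forall v, f v <= N) -> f ('v 0) = p -> holds_all X f (head_fact t ++ r) ->
    [/\ p = fact (pr t (f ('v 8))) (f ('v 4)) (f ('v 5)), f ('v 3) = pr t (f ('v 8)), f ('v 7) = t &
        holds_all (restrict N X) f r].
  move=> fN f0 /= [h1 [h2 [h3 [h4 h]]]].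
  by rewrite -f0 h2 h1 h3 h4; split=> //; apply: holds_restrict.
rewrite /some_rule /rules; set X' := restrict N X.
case=> [[f [fN f0 _ _ /(head _ _ _ fN f0)[-> e3 e7 /= h]]]|].
  by exists 0, (f ('v 8)), (f ('v 4)), (f ('v 5)); case: h.
case=> [[f [fN f0 _ _ /(head _ _ _ fN f0)[-> e3 e7 /= [h1 [h2 [h3 [h4 [h5 [h6 [h7 _]]]]]]]]]]|].
  exists 1, (f ('v 8)), (f ('v 4)), (f ('v 5)); split=> //; exists (f ('v 12)); split=> //.
  by move: h6; rewrite h5 h4 h3 h1 h2.
case=> [[f [fN f0 _ _ /(head _ _ _ fN f0)[-> e3 e7 /= [h1 [h2 _]]]]]|].
  by exists 2, (f ('v 8)), (f ('v 4)), (f ('v 5)); split=> //; constructor 1.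
case=> [[f [fN f0 _ _ /(head _ _ _ fN f0)[-> e3 e7 /= [h1 [h2 _]]]]]|].
  by exists 2, (f ('v 8)), (f ('v 4)), (f ('v 5)); split=> //; constructor 2; split=> //; exists (f ('v 9)).
case=> [[f [fN f0 _ _ /(head _ _ _ fN f0)[-> e3 e7 /= [h1 [h2 [h3 [h4 [h5 [h6 _]]]]]]]]]|].
  exists 2, (f ('v 8)), (f ('v 4)), (f ('v 5)); split=> //; constructor 3.
  exists (f ('v 9)), (f ('v 10)), (f ('v 11)); split=> //.
  by move: h6; rewrite h5 h4 h3 e7.
case=> [[f [fN f0 _ _ /(head _ _ _ fN f0)[-> e3 e7 /= [h1 [h2 [h3 [h4 [h5 [h6 [h7 _]]]]]]]]]]|].
  exists 3, (f ('v 8)), (f ('v 4)), (f ('v 5)); split=> //; exists (f ('v 9)), (f ('v 10)), (f ('v 11)).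
  by split=> //; [move: h4; rewrite h3 h2 | move: h7; rewrite h6 h5].
case=> [[f [fN f0 _ _ /(head _ _ _ fN f0)[-> e3 e7 /= [h1 [h2 [h3 [h4 [h5 [h6 _]]]]]]]]]|].
  exists 4, (f ('v 8)), (f ('v 4)), (f ('v 5)); split=> //; exists (f ('v 9)), (f ('v 10)); split=> //; left.
  by exists (f ('v 12)); rewrite h3 h2; split=> //; move: h6; rewrite h5 h4.
case=> [[f [fN f0 _ _ /(head _ _ _ fN f0)[-> e3 e7 /=
    [h1 [h2 [h3 [h4 [h5 [h6 [h7 [h8 [h9 [h10 [h11 [h12 _]]]]]]]]]]]]]]]|].
  exists 4, (f ('v 8)), (f ('v 4)), (f ('v 5)); split=> //; exists (f ('v 9)), (f ('v 10)); split=> //; right.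
  exists (f ('v 13)), (f ('v 12)), (f ('v 15)); split; first by rewrite h2 h3.
    by move: h7; rewrite h6 h5 h4 e3.
  by move: h12; rewrite h11 h10 h9 h8.
case=> [[f [fN f0 _ _ /(head _ _ _ fN f0)[-> e3 e7 /= [h1 [h2 [h3 [h4 [h5 [h6 [h7 [h8 _]]]]]]]]]]]|].
  exists 5, (f ('v 8)), (f ('v 4)), (f ('v 5)); split=> //.
  exists (f ('v 9)), (f ('v 10)), (f ('v 11)), (f ('v 12)); split=> //; first by move: h5; rewrite h4 h3.
  by move: h8; rewrite h7 h6.
case=> [[f [fN f0 _ _ /(head _ _ _ fN f0)[-> e3 e7 /= [h1 [h2 [h3 [h4 [h5 [h6 [h7 _]]]]]]]]]]|].
  exists 6, (f ('v 8)), (f ('v 4)), (f ('v 5)); split=> //=.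
  by move: h7; rewrite h6 h5 h4 h3 h2 h1.
case=> [[f [fN f0 _ _ /(head _ _ _ fN f0)[-> e3 e7 /= [h1 [h2 [h3 [h4 [h5 _]]]]]]]]|].
  exists 7, (f ('v 8)), (f ('v 4)), (f ('v 5)); split=> //; exists (f ('v 5)), (f ('v 10)); split=> //; left.
  by move: h5; rewrite h4 h3 h2.
case=> [[f [fN f0 _ _ /(head _ _ _ fN f0)[-> e3 e7 /=
    [h1 [h2 [h3 [h4 [h5 [h6 [h7 [h8 [h9 [h10 _]]]]]]]]]]]]]|//].
exists 7, (f ('v 8)), (f ('v 4)), (f ('v 5)); split=> //; exists (f ('v 9)), (f ('v 10)); split=> //; right.
by exists (f ('v 12)); split; [move: h5; rewrite h4 h3 h2 | move: h10; rewrite h9 h8 h7 h6 e3].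
Qed.

(** The witnesses do not depend on [N], which only has to be large enough. *)
Definition eventually_rule (X : nat -> bool) (p : nat) (r : seq atom) : Prop :=
  forall k, exists B, forall N, B <= N -> rule_at N X p k r.

(** The list gives the variables from ['v 3] on; unlisted ones get the default 0, and the sum is a
    crude bound for all values. *)
Lemma rule_at_seq N X p k r (vs : seq nat) : p + k + sumn vs <= N ->
  holds_all X (fun v => nth 0 [:: p, k, N & vs] v) r -> rule_at N X p k r.
Proof.
move=> le h; exists (fun v => nth 0 [:: p, k, N & vs] v); split=> // -[[|[|[|i]]] _] //=; try lia.
suff : nth 0 vs i <= sumn vs by lia.
by elim: vs i {le h} => [|x vs IH] [|i] //=; [apply: leq_addr | apply: leq_trans (IH i) (leq_addl _ _)].
Qed.

Lemma rule_intro X p r (vs : seq nat) :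
  (forall k N, holds_all X (fun v => nth 0 [:: p, k, N & vs] v) r) -> eventually_rule X p r.
Proof. by move=> h k; exists (p + k + sumn vs) => N le; apply: rule_at_seq le (h k N). Qed.

Lemma some_rule_nth X p i : i < size rules -> eventually_rule X p (nth [::] rules i) ->
  forall k, exists B, forall N, B <= N -> some_rule N X rules p k.
Proof.
move=> lt h k; have [B hB] := h k; exists B => N /hB.
rewrite /some_rule; elim: rules i lt {h hB} => [|r rs IH] [|i] //= lt h; first by left.
by right; apply: IH h.
Qed.

Lemma justified_rule X p : justified X p ->
  forall k, exists B, forall N, B <= N -> some_rule N X rules p k.
Proof.
case=> t [a [v [y [-> ]]]].
(* Values of ['v 3] to ['v 8] in the layout of [head_fact]. *)
pose hd t a v y : seq nat := [:: pr t a; v; y; pr v y; t; a].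
case: t => [|[|[|[|[|[|[|[|//]]]]]]]] /=.
- move=> ->; apply: (some_rule_nth (i := 0)) => //.
  by apply: (rule_intro (vs := hd 0 a v 0)).
- case=> x [h ->]; apply: (some_rule_nth (i := 1)) => //.
  apply: (rule_intro (vs := hd 1 a v x.+1 ++ [:: 2; 0; pr 2 0; x; pr v x; pr (pr 2 0) (pr v x)])).
  by repeat split.
- case=> [[-> ->]|[-> [v' ->]]|[j [x [v' [-> -> h]]]]].
  + apply: (some_rule_nth (i := 2)) => //.
    by apply: (rule_intro (vs := hd 2 a 0 0)).
  + apply: (some_rule_nth (i := 3)) => //.
    by apply: (rule_intro (vs := hd 2 0 (pr y v') y ++ [:: v'])).
  + apply: (some_rule_nth (i := 4)) => //.
    apply: (rule_intro (vs := hd 2 j.+1 (pr x v') y ++ [:: j; x; v'; pr 2 j; pr v' y; pr (pr 2 j) (pr v' y)])).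
    by repeat split.
- case=> f [gs [ys [-> h1 h2]]]; apply: (some_rule_nth (i := 5)) => //.
  apply: (rule_intro (vs := hd 3 (pr f gs) v y ++
    [:: f; gs; ys; pr v ys; pr gs (pr v ys); pr ys y; pr f (pr ys y)])).
  by repeat split.
- case=> f [g [-> [[v' [-> h]]|[x [v' [z [-> h1 h2]]]]]]].
    apply: (some_rule_nth (i := 6)) => //.
    apply: (rule_intro (vs := hd 4 (pr f g) (pr 0 v') y ++ [:: f; g; 0; v'; pr v' y; pr f (pr v' y)])).
    by repeat split.
  apply: (some_rule_nth (i := 7)) => //.
  apply: (rule_intro (vs := hd 4 (pr f g) (pr x.+1 v') y ++
    [:: f; g; x.+1; v'; x; pr x v'; z; pr (pr x v') z; pr (pr 4 (pr f g)) (pr (pr x v') z);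
        pr z v'; pr x (pr z v'); pr (pr x (pr z v')) y; pr g (pr (pr x (pr z v')) y)])).
  by repeat split.
- case=> g [gs [y1 [ys [-> -> h1 h2]]]]; apply: (some_rule_nth (i := 8)) => //.
  apply: (rule_intro (vs := hd 5 (pr g gs) v (pr y1 ys) ++
    [:: g; gs; y1; ys; pr v y1; pr g (pr v y1); pr v ys; pr gs (pr v ys)])).
  by repeat split.
- move=> h; apply: (some_rule_nth (i := 9)) => //.
  apply: (rule_intro (vs := hd 6 a v y ++
    [:: 7; pr 7 a; 0; pr 0 v; pr (pr 0 v) y; pr (pr 7 a) (pr (pr 0 v) y)])).
  by repeat split.
- case=> x [v' [-> [[h ->]|[z [h1 h2]]]]].
    apply: (some_rule_nth (i := 10)) => //.
    apply: (rule_intro (vs := hd 7 a (pr x v') x ++ [:: 0; v'; pr (pr x v') 0; pr a (pr (pr x v') 0)])).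
    by repeat split.
  apply: (some_rule_nth (i := 11)) => //.
  apply: (rule_intro (vs := hd 7 a (pr x v') y ++
    [:: x; v'; z.+1; z; pr (pr x v') z.+1; pr a (pr (pr x v') z.+1);
        x.+1; pr x.+1 v'; pr (pr x.+1 v') y; pr (pr 7 a) (pr (pr x.+1 v') y)])).
  by repeat split.
Qed.

Definition all_justified (X : nat -> bool) : Prop := forall p, X p -> justified X p.

Lemma derives_mono (X Y : nat -> bool) t a v y :
  (forall p, X p -> Y p) -> derives X t a v y -> derives Y t a v y.
Proof.
move=> XY; case: t => [|[|[|[|[|[|[|[|//]]]]]]]] //=.
- by case=> x [/XY h ->]; exists x.
- case=> [h|h|[j [x [v' [-> -> /XY h]]]]]; [by constructor 1 | by constructor 2 | constructor 3].
  by exists j, x, v'.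
- by case=> f [gs [ys [-> /XY h1 /XY h2]]]; exists f, gs, ys.
- case=> f [g [-> [[v' [-> /XY h]]|[x [v' [z [-> /XY h1 /XY h2]]]]]]]; exists f, g; split=> //.
    by left; exists v'.
  by right; exists x, v', z.
- by case=> g [gs [y1 [ys [-> -> /XY h1 /XY h2]]]]; exists g, gs, y1, ys.
- exact: XY.
- case=> x [v' [-> [[/XY h ->]|[z [/XY h1 /XY h2]]]]]; exists x, v'; split=> //; first by left.
  by right; exists z.
Qed.

Lemma justified_mono (X Y : nat -> bool) p : (forall p, X p -> Y p) -> justified X p -> justified Y p.
Proof. by move=> XY [t [a [v [y [-> /(derives_mono XY) d]]]]]; exists t, a, v, y. Qed.

(** Injectivity of [pr] lets the last step be read off the fact: its tag leaves a single clause. *)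
Lemma justified_inv X t a v y : all_justified X -> X (fact (pr t a) v y) -> derives X t a v y.
Proof.
move=> jX /jX[t' [a' [v' [y' [/pr_inj[/pr_inj[<- <-] /pr_inj[<- <-]] d]]]]]; exact: d.
Qed.

Definition proves (L : seq nat) (p : nat) : Prop := all_justified (fun q => q \in L) /\ p \in L.

Lemma proves_add L t a v y : all_justified (fun q => q \in L) -> derives (fun q => q \in L) t a v y ->
  proves (fact (pr t a) v y :: L) (fact (pr t a) v y).
Proof.
move=> jL d; have sub p : p \in L -> p \in fact (pr t a) v y :: L by rewrite inE orbC => ->.
split=> [p|]; last by rewrite inE eqxx.
rewrite inE => /orP[/eqP->|/jL]; last exact: justified_mono.
by exists t, a, v, y; split=> //; apply: derives_mono sub d.
Qed.

Lemma all_justified_cat L1 L2 : all_justified (fun q => q \in L1) -> all_justified (fun q => q \in L2) ->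
  all_justified (fun q => q \in L1 ++ L2).
Proof.
move=> j1 j2 p; rewrite mem_cat => /orP[/j1|/j2]; apply: justified_mono => q h.
  by rewrite mem_cat h.
by rewrite mem_cat h orbT.
Qed.

(** Uniqueness ranges over every justified [X], finite or not, with no well-foundedness asked of it:
    the induction will follow the evaluation instead. *)
Definition determined (e v y : nat) : Prop :=
  (exists L, proves L (fact e v y)) /\ forall X y', all_justified X -> X (fact e v y') -> y' = y.

Lemma pr_neq0 a b : pr a b <> 0.
Proof. by []. Qed.

(** Index and list shrink together, so the induction is on the list; the code 0 of the empty list is
    no pair, which excludes the other clauses. *)
Lemma determined_proj i v : determined (pr 2 i) (lcode v) (nth 0 v i).
Proof.
have jn : all_justified (fun q => q \in [::]) by [].
elim: v i => [|x v IH] i; rewrite ?nth_nil.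
  split=> [|X y' jX /(justified_inv jX)].
    by exists [:: fact (pr 2 i) 0 0]; apply: proves_add => //=; constructor 1.
  by case=> [[]//|[_ [v' /esym/pr_neq0]]//|[j [x [v' [_ /esym/pr_neq0]]]]].
case: i => [|i] /=.
  split=> [|X y' jX /(justified_inv jX)].
    exists [:: fact (pr 2 0) (lcode (x :: v)) x]; apply: proves_add => //=.
    by constructor 2; split=> //; exists (lcode v).
  by case=> [[/pr_neq0]//|[_ [v' /pr_inj[->]]]//|[j [x' [v' []]]]].
have [[L [jL pL]] u] := IH i.
split=> [|X y' jX /(justified_inv jX)].
  exists (fact (pr 2 i.+1) (lcode (x :: v)) (nth 0 v i) :: L); apply: proves_add => //=; constructor 3.
  by exists i, x, (lcode v).
case=> [[/pr_neq0]//|[]//|[j [x' [v' [[<-] /pr_inj[_ <-]]]]]]; exact: u.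
Qed.

Section Induction.
Variables (P : recf -> seq nat -> nat -> Prop) (Q : seq recf -> seq nat -> seq nat -> Prop).
Hypotheses
  (Pzero : forall v, P RZero v 0)
  (Psucc : forall v, P RSucc v (nth 0 v 0).+1)
  (Pproj : forall i v, P (RProj i) v (nth 0 v i))
  (Pcomp : forall f gs v ys y, Q gs v ys -> P f ys y -> P (RComp f gs) v y)
  (Pprim0 : forall f g v y, P f v y -> P (RPrim f g) (0 :: v) y)
  (PprimS : forall f g x v z y,
     P (RPrim f g) (x :: v) z -> P g (x :: z :: v) y -> P (RPrim f g) (x.+1 :: v) y)
  (Pmu : forall f v x, P f (x :: v) 0 -> (forall y, y < x -> exists z, P f (y :: v) z.+1) -> P (RMu f) v x)
  (Qnil : forall v, Q [::] v [::])
  (Qcons : forall g gs v y ys, P g v y -> Q gs v ys -> Q (g :: gs) v (y :: ys)).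

(** Written by hand: the relations are mutual, and [ev_mu] hides evaluations under [forall] and
    [exists], where the generated schemes offer no induction hypothesis. *)
Fixpoint reval_rec f v y (e : reval f v y) {struct e} : P f v y :=
  match e with
  | ev_zero v => Pzero v
  | ev_succ v => Psucc v
  | ev_proj i v => Pproj i v
  | ev_comp f gs v ys y es e => Pcomp (revals_rec es) (reval_rec e)
  | ev_prim0 f g v y e => Pprim0 g (reval_rec e)
  | ev_primS f g x v z y e1 e2 => PprimS (reval_rec e1) (reval_rec e2)
  | ev_mu f v x e h => Pmu (reval_rec e)
      (fun y lt => match h y lt with ex_intro z ez => ex_intro _ z (reval_rec ez) end)
  end
with revals_rec gs v ys (e : revals gs v ys) {struct e} : Q gs v ys :=
  match e with
  | evs_nil v => Qnil v
  | evs_cons g gs v y ys e es => Qcons (reval_rec e) (revals_rec es)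
  end.
End Induction.

Lemma reval_determined f v y : reval f v y -> determined (rcode f) (lcode v) y.
Proof.
have jn : all_justified (fun q => q \in [::]) by [].
apply: (reval_rec (P := fun f v y => determined (rcode f) (lcode v) y)
  (Q := fun gs v ys => determined (rcodes gs) (lcode v) (lcode ys))) => {f v y} /=.
- move=> v; split=> [|X y' jX /(justified_inv jX) //].
  by exists [:: fact (pr 0 0) (lcode v) 0]; apply: proves_add.
- move=> v; have [[L [jL pL]] u] := determined_proj 0 v.
  split=> [|X y' jX /(justified_inv jX)[x [/(u _ _ jX)-> ->]] //].
  by exists (fact (pr 1 0) (lcode v) (nth 0 v 0).+1 :: L); apply: proves_add => //; exists (nth 0 v 0).
- by move=> i v; apply: determined_proj.
- move=> f gs v ys y [[L1 [j1 p1]] u1] [[L2 [j2 p2]] u2]; split=> [|X y' jX].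
    exists (fact (pr 3 (pr (rcode f) (rcodes gs))) (lcode v) y :: (L1 ++ L2)).
    apply: proves_add; first exact: all_justified_cat.
    by exists (rcode f), (rcodes gs), (lcode ys); rewrite !mem_cat p1 p2 orbT.
  move/(justified_inv jX) => [f' [gs' [ys' [/pr_inj[<- <-] /(u1 _ _ jX)-> ]]]]; exact: u2.
- move=> f g v y [[L [jL pL]] u]; split=> [|X y' jX /(justified_inv jX)].
    exists (fact (pr 4 (pr (rcode f) (rcode g))) (pr 0 (lcode v)) y :: L).
    apply: proves_add => //; exists (rcode f), (rcode g); split=> //; left.
    by exists (lcode v).
  case=> f' [g' [/pr_inj[<- <-] [[v' [/pr_inj[_ <-]]]|[x [v' [z [/pr_inj[] //]]]]]]]; exact: u.
- move=> f g x v z y [[L1 [j1 p1]] u1] [[L2 [j2 p2]] u2]; split=> [|X y' jX /(justified_inv jX)].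
    exists (fact (pr 4 (pr (rcode f) (rcode g))) (pr x.+1 (lcode v)) y :: (L1 ++ L2)).
    apply: proves_add; first exact: all_justified_cat.
    exists (rcode f), (rcode g); split=> //; right.
    by exists x, (lcode v), z; rewrite !mem_cat p1 p2 orbT.
  case=> f' [g' [/pr_inj[<- <-] [[v' [/pr_inj[] //]]|[x' [v' [z' [/pr_inj[[<-] <-]]]]]]]].
  by move/(u1 _ _ jX) => -> /(u2 _ _ jX).
- move=> f v x [[L0 [j0 p0]] u0] hz.
  (* Induction on the distance [d] of the counter to the answer [x]: at [x] the function vanishes,
     before it the value [z.+1] forces one more round. *)
  have search d : d <= x -> determined (pr 7 (rcode f)) (pr (x - d) (lcode v)) x.
    elim: d => [|d IH] dx.
      rewrite subn0; split=> [|X y' jX /(justified_inv jX)].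
        exists (fact (pr 7 (rcode f)) (pr x (lcode v)) x :: L0); apply: proves_add => //.
        by exists x, (lcode v); split=> //; left.
      case=> x' [v' [/pr_inj[<- <-] [[_ -> //]|[z [/(u0 _ _ jX)]]]]] //.
    have [[L1 [j1 p1]] u1] := IH (ltnW dx).
    have [|z [[L2 [j2 p2]] u2]] := hz (x - d.+1); first by lia.
    have e : (x - d.+1).+1 = x - d by lia.
    split=> [|X y' jX /(justified_inv jX)].
      exists (fact (pr 7 (rcode f)) (pr (x - d.+1) (lcode v)) x :: (L1 ++ L2)).
      apply: proves_add; first exact: all_justified_cat.
      exists (x - d.+1), (lcode v); split=> //; right.
      by exists z; rewrite e !mem_cat p1 p2 orbT.
    case=> x' [v' [/pr_inj[<- <-] [[/(u2 _ _ jX)]|[z' [_]]]]] //.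
    by rewrite e; apply: u1.
  have := search x (leqnn x); rewrite subnn => -[[L [jL pL]] u]; split=> [|X y' jX /(justified_inv jX)].
    by exists (fact (pr 6 (rcode f)) (lcode v) x :: L); apply: proves_add.
  exact: u.
(* The empty list of functions has the code of [RZero], and its list of values has code 0, so tag 0
   serves both. *)
- move=> v; split=> [|X y' jX /(justified_inv jX) //].
  by exists [:: fact (pr 0 0) (lcode v) 0]; apply: proves_add.
- move=> g gs v y ys [[L1 [j1 p1]] u1] [[L2 [j2 p2]] u2]; split=> [|X y' jX /(justified_inv jX)].
    exists (fact (pr 5 (pr (rcode g) (rcodes gs))) (lcode v) (pr y (lcode ys)) :: (L1 ++ L2)).
    apply: proves_add; first exact: all_justified_cat.
    by exists (rcode g), (rcodes gs), y, (lcode ys); rewrite !mem_cat p1 p2 orbT.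
  by case=> g' [gs' [y1 [ys' [/pr_inj[<- <-] -> /(u1 _ _ jX)-> /(u2 _ _ jX)->]]]].
Qed.

(** The bound disappears: cutting [X] at [N] gives a finite list, and for a finite justified list
    the rules hold from some [N] on. *)
Theorem universal_rat n : exists A : dfa, forall k,
  rat_mem n A (target k) <->
  exists2 L : seq nat, all_justified (fun q => q \in L) & fact k (pr k 0) 0 \in L.
Proof.
have [A AE] := horn_rat n goal rules; exists A => k; rewrite AE; split.
  case=> N [X [_ _ [f [fN _ f1 _ /= [h1 [h2 [h3 [h4 [h5 _]]]]]]] hr]].
  have E p : (p \in [seq q <- iota 0 N.+1 | X q]) = restrict N X p.
    by rewrite mem_filter mem_iota ltnS.
  exists [seq q <- iota 0 N.+1 | X q] => [p|].
    rewrite E => /andP[Xp pN]; apply: justified_mono (some_rule_sound (hr p pN Xp)) => q.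
    by rewrite E.
  have : restrict N X (f ('v 6)) by rewrite /restrict h5 fN.
  by rewrite E h4 h3 h2 h1 f1.
case=> L jL kL.
have [B hB] : exists B, forall p, p \in L -> forall N, B <= N -> some_rule N (fun q => q \in L) rules p k.
  have sub p : p \in L -> p \in L by [].
  elim: {1 3}L sub => [|p l IH] sub; first by exists 0.
  have [B1 h1] := justified_rule (jL p (sub p (mem_head _ _))) k.
  have [|B2 h2] := IH; first by move=> q ql; apply: sub; rewrite inE ql orbT.
  exists (B1 + B2) => q; rewrite inE => /orP[/eqP->|ql] N le; [apply: h1 | apply: h2] => //; lia.
pose vs := [:: 0; pr k 0; pr (pr k 0) 0; fact k (pr k 0) 0].
exists (B + k + sumn vs).+1, (fun q => q \in L); split=> //; first by lia.
  by apply: (rule_at_seq (vs := vs)); [lia | repeat split].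
by move=> p _ pL; apply: hB => //; lia.
Qed.

(** * The encoded target as a recursive function, and the diagonal argument *)

Definition recf_add : recf := RPrim (RProj 0) (RComp RSucc [:: RProj 1]).

Lemma reval_comp1 f g v x y : reval g v x -> reval f [:: x] y -> reval (RComp f [:: g]) v y.
Proof. by move=> gx fy; apply: ev_comp fy; apply: evs_cons gx (evs_nil _). Qed.

Lemma reval_comp2 f g h v a b y :
  reval g v a -> reval h v b -> reval f [:: a; b] y -> reval (RComp f [:: g; h]) v y.
Proof. by move=> ga hb fy; apply: ev_comp fy; apply: evs_cons ga (evs_cons hb (evs_nil _)). Qed.

Lemma reval_succ f v x : reval f v x -> reval (RComp RSucc [:: f]) v x.+1.
Proof. by move=> fx; apply: reval_comp1 fx (ev_succ _). Qed.

Lemma reval_add a b : reval recf_add [:: a; b] (a + b).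
Proof.
elim: a => [|a IH]; first exact/ev_prim0/ev_proj.
by apply: ev_primS IH _; apply/reval_succ/ev_proj.
Qed.

Definition recf_succs (c : nat) (f : recf) : recf := iter c (fun f => RComp RSucc [:: f]) f.

Lemma reval_succs c f v x : reval f v x -> reval (recf_succs c f) v (c + x).
Proof. by move=> fx; elim: c => //= c; apply: reval_succ. Qed.

Definition recf_muln (c : nat) (f : recf) : recf := iter c (fun g => RComp recf_add [:: f; g]) RZero.

Lemma reval_muln c f v x : reval f v x -> reval (recf_muln c f) v (c * x).
Proof.
move=> fx; elim: c => [|c IH]; first exact: ev_zero.
by rewrite mulSn; apply: reval_comp2 fx IH (reval_add _ _).
Qed.

(* Prepending the letter [Lt] sends the code [c] to [3 + 7 * c]. *)
Definition recf_target : recf :=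
  RComp (RPrim (recf_succs 2 RZero) (recf_succs 3 (recf_muln 7 (RProj 1)))) [:: RProj 0].

Lemma reval_target k : reval recf_target [:: k] (encode (target k)).
Proof.
apply: reval_comp1 (ev_proj _ _) _ => /=; elim: k => [|k IH].
  (* The base value 2 is the code of the one-letter word [[:: LaI]]. *)
  exact/ev_prim0/(reval_succs 2)/ev_zero.
by apply: ev_primS IH _; apply/(reval_succs 3)/(reval_muln 7)/ev_proj.
Qed.

Theorem theorem5 (n : nat) (hn : (2 <= n)%N) :
  exists A : dfa, ~ decidable_words (rat_mem n A).
Proof.
have [A AE] := universal_rat n; exists A => -[d dP].
(* Diagonal choice: on its own code k, [f] asks the procedure about [target k]. *)
pose f := RComp d [:: recf_target]; pose k := rcode f.
have fP b : reval d [:: encode (target k)] b -> determined k (pr k 0) b.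
  by move/(reval_comp1 (reval_target k))/reval_determined.
have [dT dF] := dP (target k).
(* For a member the answer would be 1, so no justified list could contain the fact with value 0,
   against [AE]. *)
have nP : ~ rat_mem n A (target k).
  move=> P; have [_ u] := fP _ (dT P).
  by have /AE[L jL kL] := P; have := u _ _ jL kL.
(* Now the answer is 0, which yields a justified list with the value 0 and makes the word a
   member. *)
have [[L [jL kL]] _] := fP _ (dF nP).
by apply/nP/AE; exists L.
Qed.
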